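(* The $\mathcal{L}_{L}$-structure $L(\mathbb{I})$ is model-complete; i.e. every $\mathcal{L}_L$-formula $\phi(\bar X)$ is equivalent in $L(\mathbb{I})$ to an existential $\mathcal{L}_L$-formula $\phi^*(\bar X)$, that is, $L(\mathbb{I})\models\forall\bar X(\phi(\bar X)\leftrightarrow\phi^*(\bar X))$.
   Context: $\mathbb{I}$ is a fixed dense linear order with a least element, denoted $0$, and no greatest element. A closed interval of $\mathbb{I}$ is a set of the form $[i,j]=\{k: i\le k\le j\}$, $[i,+\infty)=\{k: i\le k\}$ or $(-\infty,j]=\{k:k\le j\}$ for $i,j\in\mathbb{I}$. $\mathcal{P}_{\mathrm{fci}}(\mathbb{I})$ is the set of finite unions of closed intervals of $\mathbb{I}$ (including $\emptyset$). For $A\in\mathcal{P}_{\mathrm{fci}}(\mathbb{I})$, write $A$ as the union of its finitely many maximal convex subsets (each a closed interval); $A_l$ (the left endpoints of $A$) is the set of least elements of these, and $A_r$ (the right endpoints) is the set of greatest elements of those that have one. $\mathcal{L}_{L}$ is the signature $\{\cup,\cap,\bot,\mathbf{0},\min,\max,l,r\}$ (two binary function symbols, two constants, four unary function symbols). $L(\mathbb{I})$ is the $\mathcal{L}_L$-structure with universe $\mathcal{P}_{\mathrm{fci}}(\mathbb{I})$, $\cup,\cap$ union and intersection, $\bot=\emptyset$, $\mathbf{0}=\{0\}$, $\min(A)$ the singleton of the least element of $A$ ($\min(\emptyset)=\emptyset$), $\max(A)$ the singleton of the greatest element of $A$ if $A$ is nonempty and bounded above and $\emptyset$ otherwise, $l(A)=A_l$,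 $r(A)=A_r$. *)

(* Defs.v *)
From mathcomp Require Import all_boot all_order interval.
From mathcomp Require Import boolp classical_sets cardinality set_interval.

Set Implicit Arguments.
Unset Strict Implicit.
Unset Printing Implicit Defensive.

Import Order.TTheory.
Local Open Scope order_scope.
Local Open Scope classical_set_scope.

(** * First-order logic over a signature without relation symbols *)

Record signature := Signature { symbol :> Type; arity : symbol -> nat }.

Section Syntax.
Variable S : signature.

Inductive term (n : nat) : Type :=
| Var of 'I_n
| App (f : S) of 'I_(arity f) -> term n.

(* [formula n]: formulas whose free variables are among the n variables 'I_n.
   The bodies of [Ex] and [All] have one more variable, which is [ord0]; the
   variable [i] of the quantified formula becomes [lift ord0 i] in the body. *)
Inductive formula : nat -> Type :=
| Eq n of term n & term n : formula n
| Neg n of formula n : formula n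
| And n of formula n & formula n : formula n
| Or n of formula n & formula n : formula n
| Imp n of formula n & formula n : formula n
| Ex n of formula n.+1 : formula n
| All n of formula n.+1 : formula n.

Fixpoint quantifier_free n (phi : formula n) : bool :=
  match phi with
  | Eq _ _ _ => true
  | Neg _ p => quantifier_free p
  | And _ p q | Or _ p q | Imp _ p q => quantifier_free p && quantifier_free q
  | Ex _ _ | All _ _ => false
  end.

(* a (possibly empty) block of existential quantifiers followed by a
   quantifier-free formula *)
Fixpoint existential n (phi : formula n) : bool :=
  match phi with
  | Ex _ p => existential p
  | q => quantifier_free q
  end.

Record structure := Structure {
  carrier :> Type;
  interp : forall f : S, ('I_(arity f) -> carrier) -> carrier }.

Fixpoint eval (M : structure) n (v : 'I_n -> M) (t : term n) : M :=
  match t with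
  | Var i => v i
  | App f args => interp (fun k => eval v (args k))
  end.

Definition extend (T : Type) n (a : T) (v : 'I_n -> T) : 'I_n.+1 -> T :=
  fun i => if unlift ord0 i is Some j then v j else a.

Fixpoint sat (M : structure) n (phi : formula n) : ('I_n -> M) -> Prop :=
  match phi with
  | Eq _ s t => fun v => eval v s = eval v t
  | Neg _ p => fun v => ~ sat p v
  | And _ p q => fun v => sat p v /\ sat q v
  | Or _ p q => fun v => sat p v \/ sat q v
  | Imp _ p q => fun v => sat p v -> sat q v
  | Ex _ p => fun v => exists a : M, sat p (extend a v)
  | All _ p => fun v => forall a : M, sat p (extend a v)
  end.

Definition model_complete (M : structure) : Prop :=
  forall (n : nat) (phi : formula n),
    exists2 psi : formula n, existential psi &
      forall v : 'I_n -> M, sat phi v <-> sat psi v.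

End Syntax.

(** * Finite unions of closed intervals *)

Section ClosedIntervals.
Context {d : Order.disp_t} {I : bOrderType d}.
Implicit Types (A B C : set I) (x y : I).

Definition closed_interval A : Prop :=
  [\/ exists i j : I, A = `[i, j]%classic,
      exists i : I, A = `[i, +oo[%classic |
      exists j : I, A = `]-oo, j]%classic].

Definition fci A : Prop :=
  exists (n : nat) (F : nat -> set I),
    (forall k, (k < n)%N -> closed_interval (F k)) /\ A = \bigcup_(k < n) F k.

(* the set of least (resp. greatest) elements of A: empty or a singleton; see
   [fci_min], [fci_max] and [fci_max0] below *)
Definition least A : set I := A `&` lbound A.
Definition greatest A : set I := A `&` ubound A.

Definition convex A : Prop :=
  forall x y z, A x -> A z -> x <= y -> y <= z -> A y.

Definition maximal_convex A C : Prop :=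
  [/\ C `<=` A, convex C &
      forall D, D `<=` A -> convex D -> C `<=` D -> D = C].

Definition left_endpoints A : set I :=
  [set x | exists2 C, maximal_convex A C & least C x].
Definition right_endpoints A : set I :=
  [set x | exists2 C, maximal_convex A C & greatest C x].

Lemma fci_interval A : closed_interval A -> fci A.
Proof.
move=> hA; exists 1%N, (fun=> A); split => //.
by apply/seteqP; split=> [x Ax|x [k _ Ax]] //; exists 0%N.
Qed.

Lemma fci0 : fci set0.
Proof. by exists 0%N, (fun=> set0); split=> //; rewrite bigcup0. Qed.

Lemma fci1 x : fci [set x].
Proof.
by apply: fci_interval; constructor 1; exists x, x; rewrite set_itv1.
Qed.

Lemma fciU A B : fci A -> fci B -> fci (A `|` B).
Proof.
move=> [n [F [hF ->]]] [m [G [hG ->]]].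
exists (n + m)%N, (fun k => if (k < n)%N then F k else G (k - n)%N); split.
  move=> k lk; case: ltnP => [/hF//|le_nk]; apply: hG.
  by rewrite ltn_subLR.
apply/seteqP; split=> x.
  move=> [[k /= lk Fx]|[k /= lk Gx]].
    by exists k => /=; [apply: ltn_addr | rewrite lk].
  exists (n + k)%N => /=; first by rewrite ltn_add2l.
  by rewrite ltnNge leq_addr /= addKn.
move=> [k /= lk]; case: ltnP => [lkn Fx|le_nk Gx].
  by left; exists k.
by right; exists (k - n)%N => //=; rewrite ltn_subLR.
Qed.

Lemma fci_bigcup n (F : nat -> set I) :
  (forall k, (k < n)%N -> fci (F k)) -> fci (\bigcup_(k < n) F k).
Proof.
rewrite bigcup_mkord; elim: n => [|n IHn] hF.
  by rewrite big_ord0; exact: fci0.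
rewrite big_ord_recr; apply: fciU; last exact: hF.
by apply: IHn => k lk; apply: hF; exact: ltnW.
Qed.

Lemma closed_intervalP A : closed_interval A ->
  exists i, (exists j, A = `[i, j]%classic) \/ A = `[i, +oo[%classic.
Proof.
move=> [[i [j ->]]|[i ->]|[j ->]].
- by exists i; left; exists j.
- by exists i; right.
exists \bot; left; exists j; rewrite !set_itvE.
by apply/seteqP; split=> x /=; rewrite le0x.
Qed.

Lemma closed_intervalI A B :
  closed_interval A -> closed_interval B -> closed_interval (A `&` B).
Proof.
move=> /closed_intervalP[i hA] /closed_intervalP[k hB].
case: hA => [[j ->]|->]; case: hB => [[l ->]|->].
- constructor 1; exists (Order.max i k), (Order.min j l).
  rewrite !set_itvE; apply/seteqP; split=> x /=; rewrite ge_max le_min.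
    by move=> [/andP[-> ->] /andP[-> ->]].
  by move=> /andP[/andP[-> ->] /andP[-> ->]].
- constructor 1; exists (Order.max i k), j.
  rewrite !set_itvE; apply/seteqP; split=> x /=; rewrite ge_max.
    by move=> [/andP[-> ->] ->].
  by move=> /andP[/andP[-> ->] ->].
- constructor 1; exists (Order.max i k), l.
  rewrite !set_itvE; apply/seteqP; split=> x /=; rewrite ge_max.
    by move=> [-> /andP[-> ->]].
  by move=> /andP[/andP[-> ->] ->].
- constructor 2; exists (Order.max i k).
  rewrite !set_itvE; apply/seteqP; split=> x /=; rewrite ge_max.
    by move=> [-> ->].
  by move=> /andP[-> ->].
Qed.

Lemma fciI A B : fci A -> fci B -> fci (A `&` B).
Proof.
move=> [n [F [hF ->]]] [m [G [hG ->]]].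
rewrite setI_bigcupl; apply: fci_bigcup => k lk.
rewrite setI_bigcupr; apply: fci_bigcup => l ll.
by apply: fci_interval; apply: closed_intervalI; [exact: hF | exact: hG].
Qed.

Lemma fci_finite A : finite_set A -> fci A.
Proof.
move=> /finite_seqP[s ->]; elim: s => [|x s IHs].
  by rewrite set_nil; exact: fci0.
suff -> : [set` x :: s] = [set x] `|` [set` s] by exact: fciU (fci1 x) IHs.
apply/seteqP; split=> y /=; rewrite inE; first by move=> /orP[/eqP|]; [left|right].
by move=> [->|ys]; rewrite ?eqxx// ys orbT.
Qed.

Lemma finite_subsingleton A : (forall x y, A x -> A y -> x = y) ->
  finite_set A.
Proof.
move=> hA; have [->|/set0P[x Ax]] := eqVneq A set0; first exact: finite_set0.
by apply: sub_finite_set (finite_set1 x) => y Ay; rewrite (hA _ _ Ay Ax).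
Qed.

Lemma finite_least A : finite_set (least A).
Proof.
apply: finite_subsingleton => x y [Ax lx] [Ay ly].
by apply/le_anti; rewrite lx ?ly.
Qed.

Lemma finite_greatest A : finite_set (greatest A).
Proof.
apply: finite_subsingleton => x y [Ax lx] [Ay ly].
by apply/le_anti; rewrite lx ?ly.
Qed.

Lemma convex_closed_interval A : closed_interval A -> convex A.
Proof.
move=> /closed_intervalP[i [[j ->]|->]] x y z; rewrite !set_itvE /=.
  move=> /andP[ix _] /andP[_ zj] xy yz.
  by rewrite (le_trans ix xy) (le_trans yz zj).
by move=> ix _ xy _; exact: le_trans ix xy.
Qed.

Lemma convexU A B x : convex A -> convex B -> A x -> B x -> convex (A `|` B).
Proof.
move=> cA cB Ax Bx a b c hA hB ab bc.
have [bx|xb] := leP b x.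
  by case: hA => ha; [left; apply: (cA a b x) | right; apply: (cB a b x)].
case: hB => hc; [left; apply: (cA x b c) | right; apply: (cB x b c)] => //.
all: exact: ltW.
Qed.

Lemma maximal_convex_piece n (F : nat -> set I) C x :
  (forall k, (k < n)%N -> closed_interval (F k)) ->
  maximal_convex (\bigcup_(k < n) F k) C -> C x ->
  exists k, [/\ (k < n)%N, F k x & F k `<=` C].
Proof.
move=> hF [CA cC maxC] Cx; have [k /= lk Fx] := CA _ Cx; exists k; split=> //.
have <- : C `|` F k = C.
  apply: maxC; [|by apply: (convexU (x := x)) => //;
    apply: convex_closed_interval; exact: hF|by move=> y; left].
  by move=> y [/CA//|Fy]; exists k.
by move=> y; right.
Qed.

Lemma finite_left_endpoints A : fci A -> finite_set (left_endpoints A).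
Proof.
move=> [n [F [hF ->]]].
apply: (@sub_finite_set _ _ (\bigcup_(k < n) least (F k))); last first.
  by apply: bigcup_finite => [|k _]; [exact: finite_II | exact: finite_least].
move=> x [C mC [Cx lx]].
have [k [lk Fx FC]] := maximal_convex_piece hF mC Cx.
by exists k => //; split=> // y /FC /lx.
Qed.

Lemma finite_right_endpoints A : fci A -> finite_set (right_endpoints A).
Proof.
move=> [n [F [hF ->]]].
apply: (@sub_finite_set _ _ (\bigcup_(k < n) greatest (F k))); last first.
  by apply: bigcup_finite => [|k _];
    [exact: finite_II | exact: finite_greatest].
move=> x [C mC [Cx lx]].
have [k [lk Fx FC]] := maximal_convex_piece hF mC Cx.
by exists k => //; split=> // y /FC /lx.
Qed.

Lemma least_set1 A x : least A x -> least A = [set x].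
Proof.
move=> [Ax lx]; apply/seteqP; split=> [y [Ay ly]|y ->] //.
by apply/le_anti; rewrite lx ?ly.
Qed.

Lemma greatest_set1 A x : greatest A x -> greatest A = [set x].
Proof.
move=> [Ax lx]; apply/seteqP; split=> [y [Ay ly]|y ->] //.
by apply/le_anti; rewrite lx ?ly.
Qed.

Lemma fci_min A : fci A -> A !=set0 -> exists x, least A = [set x].
Proof.
move=> [n [F [hF ->]]] A0.
suff [x lx] : least (\bigcup_(k < n) F k) !=set0.
  by exists x; exact: least_set1.
move: A0; rewrite !bigcup_mkord; elim: n hF => [|n IHn] hF.
  by rewrite big_ord0 => -[].
rewrite big_ord_recr /=; set B := \big[_/_]_(_ < _) _ => BF0.
have {}IHn : B !=set0 -> least B !=set0.
  by apply: IHn => k lk; apply: hF; exact: ltnW.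
have lF : F n !=set0 -> least (F n) !=set0.
  have /closed_intervalP[i [[j ->]|->]] := hF n (ltnSn n);
    rewrite !set_itvE => -[x /= hx]; exists i; split=> [|y] /=.
  - by move: hx => /andP[ix xj]; rewrite lexx (le_trans ix xj).
  - by move=> /andP[].
  - exact: lexx.
  - by [].
have [BE|/set0P/IHn[b [Bb lb]]] := eqVneq B set0.
  by move: BF0; rewrite BE set0U.
have [FE|/set0P/lF[c [Fc lc]]] := eqVneq (F n) set0.
  by rewrite FE setU0; exists b.
have [bc|cb] := leP b c.
  exists b; split; first by left.
  by move=> y [/lb//|/lc]; exact: le_trans.
exists c; split; first by right.
by move=> y [/lb|/lc//]; apply: le_trans; exact: ltW.
Qed.

Lemma fci_max (nomax : forall x, exists y, x < y) A : fci A -> A !=set0 -> has_ubound A ->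
  exists x, greatest A = [set x].
Proof.
move=> [n [F [hF ->]]] A0 Ab.
suff [x lx] : greatest (\bigcup_(k < n) F k) !=set0.
  by exists x; exact: greatest_set1.
move: A0 Ab; rewrite !bigcup_mkord; elim: n hF => [|n IHn] hF.
  by rewrite big_ord0 => -[].
rewrite big_ord_recr /=; set B := \big[_/_]_(_ < _) _ => BF0 [u ubF].
have {}IHn : B !=set0 -> greatest B !=set0.
  move=> B0; apply: IHn => //; first by move=> k lk; apply: hF; exact: ltnW.
  by exists u => y By; apply: ubF; left.
have lF : F n !=set0 -> greatest (F n) !=set0.
  move=> [x]; have := ubF; rewrite setUC.
  have /closed_intervalP[i [[j ->]|->]] := hF n (ltnSn n);
    rewrite !set_itvE => ub /= hx.
    move: hx => /andP[ix xj]; exists j; split=> [|y] /=; last by case/andP.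
    by rewrite lexx (le_trans ix xj).
  have [y uy] := nomax u; have := ub (Order.max i y).
  rewrite ge_max => /(_ _)/andP[|_ yu]; first by left; rewrite /= le_max lexx.
  by move: uy; rewrite ltNge yu.
have [BE|/set0P/IHn[b [Bb lb]]] := eqVneq B set0.
  by move: BF0; rewrite BE set0U.
have [FE|/set0P/lF[c [Fc lc]]] := eqVneq (F n) set0.
  by rewrite FE setU0; exists b.
have [bc|cb] := leP b c.
  exists c; split; first by right.
  by move=> y [/lb yb|/lc//]; exact: le_trans bc.
exists b; split; first by left.
by move=> y [/lb//|/lc yc]; apply: le_trans yc _; exact: ltW.
Qed.

Lemma fci_max0 A : ~ (A !=set0 /\ has_ubound A) -> greatest A = set0.
Proof.
by move=> nA; apply/seteqP; split=> // x [Ax ux]; apply: nA; split; exists x.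
Qed.

Lemma fci_least A : fci (least A).
Proof. exact/fci_finite/finite_least. Qed.

Lemma fci_greatest A : fci (greatest A).
Proof. exact/fci_finite/finite_greatest. Qed.

Lemma fci_left_endpoints A : fci A -> fci (left_endpoints A).
Proof. by move=> /finite_left_endpoints/fci_finite. Qed.

Lemma fci_right_endpoints A : fci A -> fci (right_endpoints A).
Proof. by move=> /finite_right_endpoints/fci_finite. Qed.

End ClosedIntervals.

(** * The structure L(I) *)

Inductive LL_symbol : Type :=
  LLcup | LLcap | LLbot | LLzero | LLmin | LLmax | LLl | LLr.

Definition LL_arity (f : LL_symbol) : nat :=
  match f with
  | LLcup | LLcap => 2
  | LLbot | LLzero => 0
  | LLmin | LLmax | LLl | LLr => 1
  end.

Definition LL : signature := Signature LL_arity.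

Definition Pfci d (I : bOrderType d) : Type := {A : set I | fci A}.

Definition LI_interp d (I : bOrderType d) (f : LL) :
    ('I_(arity f) -> Pfci I) -> Pfci I :=
  match f return ('I_(LL_arity f) -> Pfci I) -> Pfci I with
  | LLcup => fun a => exist _ _ (fciU (svalP (a ord0)) (svalP (a ord_max)))
  | LLcap => fun a => exist _ _ (fciI (svalP (a ord0)) (svalP (a ord_max)))
  | LLbot => fun _ => exist _ _ fci0
  | LLzero => fun _ => exist _ _ (fci1 \bot)
  | LLmin => fun a => exist _ _ (fci_least (sval (a ord0)))
  | LLmax => fun a => exist _ _ (fci_greatest (sval (a ord0)))
  | LLl => fun a => exist _ _ (fci_left_endpoints (svalP (a ord0)))
  | LLr => fun a => exist _ _ (fci_right_endpoints (svalP (a ord0)))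
  end.

Definition LI d (I : bOrderType d) : structure LL := Structure (@LI_interp d I).

(* Main.v *)
Require Import Defs.
From mathcomp Require Import all_boot all_order interval.
From mathcomp Require Import boolp classical_sets set_interval.

(* A relation between finite unions of closed intervals is called recognizable
   when it is a projection of a local relation, that is, one which constrains, at
   each point p, only whether p = 0 and which of the sets contain p, an interval
   to the left of p and an interval to the right of p, together with which of the
   sets are unbounded.  Such a tuple of sets is a finite word whose letters are
   spread over points and gaps, and a local relation is a tiling condition on it.
   Recognizable relations are closed under existential quantification for free,
   and under complement by a subset construction whose states are themselves
   coded by finite unions of closed intervals.  Hence every formula defines a
   recognizable relation.  Conversely local relations are quantifier-free
   definable: "A contains an interval to the left of p" means that p is in A but
   is not a left endpoint of A. *)

Set Implicit Arguments.
Unset Strict Implicit.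
Unset Printing Implicit Defensive.

Import Order.TTheory.
Local Open Scope order_scope.
Local Open Scope classical_set_scope.

(** * Germs of finite unions of closed intervals *)

Section TameSets.
Context {d : Order.disp_t} {I : bOrderType d}.
Implicit Types (A B J : set I) (p q x y : I).

Lemma fci_ind (Q : set I -> Prop) :
  Q set0 -> (forall i j, Q [set x | i <= x <= j]) ->
  (forall i, Q [set x | i <= x]) ->
  (forall A B, Q A -> Q B -> Q (A `|` B)) -> forall A, fci A -> Q A.
Proof.
move=> Q0 Qc Qr QU A [n [F [hF ->]]].
rewrite bigcup_mkord; elim: n hF => [|n IHn] hF; first by rewrite big_ord0.
rewrite big_ord_recr /=; apply: QU.
  by apply: IHn => k lk; apply: hF; exact: ltnW.
have /closed_intervalP[i [[j ->]|->]] := hF n (ltnSn n); rewrite set_itvE.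
  exact: Qc.
exact: Qr.
Qed.

(** [S] collects the endpoints of the intervals that make up [A]. A convex set that avoids them
    cannot cross the boundary of any of these intervals, so [A] is constant on it. *)
Lemma fci_tame A : fci A -> exists S : seq I, forall J, convex J ->
  (forall x, x \in S -> ~ J x) ->
  exists b : bool, forall x, J x -> A x <-> b.
Proof.
move=> fA; elim/fci_ind: A / fA => [|i j|i|A B [S hS] [T hT]].
- by exists [::] => J _ _; exists false.
- exists [:: i; j] => J cJ nJ.
  have [[x [Jx xij]]|N] := pselect (exists x, J x /\ i <= x <= j); last first.
    by exists false => x Jx; split=> // xij; case: N; exists x.
  exists true => y Jy; split=> // _; case/andP: xij => ix xj.
  apply/andP; split; rewrite leNgt; apply/negP => lt.
    by apply: (nJ i); rewrite ?inE ?eqxx//; apply: (cJ y i x) => //; exact: ltW.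
  apply: (nJ j); rewrite ?inE ?eqxx ?orbT//.
  by apply: (cJ x j y) => //; exact: ltW.
- exists [:: i] => J cJ nJ.
  have [[x [Jx ix]]|N] := pselect (exists x, J x /\ i <= x); last first.
    by exists false => x Jx; split=> // xij; case: N; exists x.
  exists true => y Jy; split=> // _; rewrite /= leNgt; apply/negP => lt.
  by apply: (nJ i); rewrite ?inE ?eqxx//; apply: (cJ y i x) => //; exact: ltW.
exists (S ++ T) => J cJ nJ.
have [|b hb] := hS J cJ; first by move=> x xS; apply: nJ; rewrite mem_cat xS.
have [|c hc] := hT J cJ.
  by move=> x xS; apply: nJ; rewrite mem_cat xS orbT.
exists (b || c) => x Jx; have := hb x Jx; have := hc x Jx.
by move=> e1 e2; rewrite /setU /= e1 e2; split=> /orP.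
Qed.

(** Topological closedness of [A], in one-sided form; it is what places [p] in [A] when [A] contains
    an interval adjacent to [p]. *)
Lemma fci_open_right A p q : fci A -> p < q -> ~ A p ->
  exists2 r, p < r <= q & forall x, p < x < r -> ~ A x.
Proof.
move=> fA pq; elim/fci_ind: A / fA => [|i j|i|A B hA hB] /=.
- by move=> _; exists q; [rewrite pq lexx|move=> x _ []].
- move=> /negP; rewrite negb_and -!ltNge => /orP[pi|jp].
    exists (Order.min i q); first by rewrite lt_min pi pq ge_min lexx orbT.
    move=> x /andP[_]; rewrite lt_min => /andP[xi _] /andP[ix _].
    by move: xi; rewrite ltNge ix.
  exists q; first by rewrite pq lexx.
  by move=> x /andP[px _] /andP[_ /(lt_le_trans px)/(lt_trans jp)]; rewrite ltxx.
- move=> /negP; rewrite -ltNge => pi.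
  exists (Order.min i q); first by rewrite lt_min pi pq ge_min lexx orbT.
  move=> x /andP[_]; rewrite lt_min => /andP[xi _] ix.
  by move: xi; rewrite ltNge ix.
move=> N; have [|r /andP[pr rq] hr] := hA; first by move=> Ap; apply: N; left.
have [|s /andP[ps sq] hs] := hB; first by move=> Ap; apply: N; right.
exists (Order.min r s); first by rewrite lt_min pr ps ge_min rq.
move=> x /andP[px]; rewrite lt_min => /andP[xr xs] [].
  by apply: hr; rewrite px.
by apply: hs; rewrite px.
Qed.

Lemma fci_open_left A p q : fci A -> q < p -> ~ A p ->
  exists2 r, q <= r < p & forall x, r < x < p -> ~ A x.
Proof.
move=> fA pq; elim/fci_ind: A / fA => [|i j|i|A B hA hB] /=.
- by move=> _; exists q; [rewrite pq lexx|move=> x _ []].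
- move=> /negP; rewrite negb_and -!ltNge => /orP[pi|jp].
    exists q; first by rewrite pq lexx.
    by move=> x /andP[_ px] /andP[/le_lt_trans/(_ px)/(lt_trans pi)]; rewrite ltxx.
  exists (Order.max j q); first by rewrite gt_max jp pq le_max lexx orbT.
  move=> x /andP[]; rewrite gt_max => /andP[jx _] _ /andP[_ xj].
  by move: jx; rewrite ltNge xj.
- move=> /negP; rewrite -ltNge => pi.
  exists q; first by rewrite pq lexx.
  by move=> x /andP[_ xp] /le_lt_trans/(_ xp)/(lt_trans pi); rewrite ltxx.
move=> N; have [|r /andP[qr rp] hr] := hA; first by move=> Ap; apply: N; left.
have [|s /andP[qs sp] hs] := hB; first by move=> Ap; apply: N; right.
exists (Order.max r s); first by rewrite gt_max rp sp le_max qr.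
move=> x /andP[]; rewrite gt_max => /andP[rx sx] xp [].
  by apply: hr; rewrite rx.
by apply: hs; rewrite sx.
Qed.

(** The convex component of [p]: the points whose closed segment to [p] stays in [A]. *)
Definition component A p : set I :=
  [set x | forall y, Order.min x p <= y <= Order.max x p -> A y].

Lemma component_maximal A p : A p -> maximal_convex A (component A p).
Proof.
move=> Ap; split.
- by move=> x; apply; rewrite ge_min le_max lexx.
- move=> x y z Cx Cz xy yz t; rewrite ge_min le_max => /andP[a b].
  have [tp|pt] := leP t p.
    apply: Cx; rewrite ge_min le_max tp orbT andbT.
    by case/orP: a => [/(le_trans xy)->|->] //; rewrite orbT.
  apply: Cz; rewrite ge_min le_max (ltW pt) orbT /=.
  case/orP: b => [/le_trans/(_ yz)->|] //.
  by rewrite leNgt pt.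
move=> D DA cD CD; apply/seteqP; split=> // x Dx y.
have Dp : D p.
  apply: CD => z; rewrite minxx maxxx => /le_anti <- //.
rewrite ge_min le_max => /andP[a b]; apply: DA.
by case: (leP x y) a b => [xy _|yx /= py];
  case: (leP y x) => [yx' _|xy' /= yp];
  [rewrite (@le_anti _ _ y x)// ?xy ?yx' | apply: (cD x y p)
  | apply: (cD p y x) | move: (lt_trans yx xy'); rewrite ltxx].
Qed.

Lemma left_endpointsI A p : A p ->
  (forall x, x < p -> exists2 y, x <= y < p & ~ A y) -> left_endpoints A p.
Proof.
move=> Ap h; exists (component A p); first exact: component_maximal.
split; first by move=> z; rewrite minxx maxxx => /le_anti <-.
move=> x Cx; rewrite leNgt; apply/negP => xp; have [y /andP[xy yp]] := h _ xp.
by apply; apply: Cx; rewrite ge_min le_max xy (ltW yp) orbT.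
Qed.

Lemma right_endpointsI A p : A p ->
  (forall x, p < x -> exists2 y, p < y <= x & ~ A y) -> right_endpoints A p.
Proof.
move=> Ap h; exists (component A p); first exact: component_maximal.
split; first by move=> z; rewrite minxx maxxx => /le_anti <-.
move=> x Cx; rewrite leNgt; apply/negP => xp; have [y /andP[py yx]] := h _ xp.
by apply; apply: Cx; rewrite ge_min le_max yx (ltW py) orbT.
Qed.

Lemma left_endpoints_sub A p : left_endpoints A p -> A p.
Proof. by move=> [C [CA _ _] [/CA]]. Qed.

Lemma right_endpoints_sub A p : right_endpoints A p -> A p.
Proof. by move=> [C [CA _ _] [/CA]]. Qed.

End TameSets.

(** Joins visible and auxiliary indices; [T] is either the type of sets or [bool], so families and
    letters are glued alike. *)
Definition glue (T U1 U2 : Type) (v : U1 -> T) (z : U2 -> T) : U1 + U2 -> T :=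
  fun x => match x with inl i => v i | inr j => z j end.

Lemma glueE (T U1 U2 : Type) (h : U1 + U2 -> T) :
  h = glue (h \o inl) (h \o inr).
Proof. by apply/funext; case. Qed.

Definition letter_sub (U : Type) (a b : U -> bool) := forall i, a i -> b i.

Section Germs.
Context {d : Order.disp_t} {I : bOrderType d}.
Hypothesis dense : forall x y : I, x < y -> exists z : I, x < z /\ z < y.
Hypothesis nomax : forall x : I, exists y : I, x < y.
Implicit Types (A B : set I) (p q r x y : I).

(** The germs are phrased through endpoints, which are expressible by the symbols [l] and [r];
    [left_inP] and [right_inP] recover the topological meaning. *)
Definition left_in A p := A p /\ ~ left_endpoints A p.
Definition right_in A p := A p /\ ~ right_endpoints A p.
Definition end_in A := A !=set0 /\ greatest A = set0.

(** Forwards, [A] is constant between the last breakpoint before [p] and [p]; if it were absent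
    there, [p] would be a left endpoint. Backwards, a component starting at [p] could be enlarged to
    the left. *)
Lemma left_inP A p : fci A ->
  left_in A p <-> exists2 q, q < p & forall x, q < x < p -> A x.
Proof.
move=> fA; split=> [[Ap nl]|[q qp h]].
  apply: contrapT => N; apply: nl; apply: left_endpointsI => // x xp.
  have [S hS] := fci_tame fA.
  (* The last breakpoint before [p], with default [x] so that the point found after [m] also lies
     after [x]. *)
  pose m := \big[Order.max/x]_(s <- S | s < p) s.
  have mp : m < p by rewrite /m; elim/big_ind: _ => // a b ap bp; rewrite gt_max ap.
  have xm : x <= m by apply: bigmax_ge_id.
  have [|s sS|b hb] := hS [set y | m < y < p].
  - move=> a b c /= /andP[ma _] /andP[_ cp] ab bc.
    by rewrite (lt_le_trans ma ab) (le_lt_trans bc cp).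
  - by move=> /= /andP[+ sp]; apply/negP; rewrite -leNgt; exact: le_bigmax_seq.
  case: b hb => hb; first by case: N; exists m => // y /hb[_]; apply.
  have [y [my yp]] := dense mp; exists y; first by rewrite (le_trans xm (ltW my)).
  by have/= := hb y; rewrite my yp => /(_ isT)[nA _] /nA.
have Ap : A p.
  apply: contrapT => nA; have [r /andP[qr rp] hr] := fci_open_left fA qp nA.
  have [y [ry yp]] := dense rp.
  by apply: (hr y); rewrite ?ry ?yp//; apply: h; rewrite (le_lt_trans qr ry).
split=> // -[C [CA cC maxC] [Cp lp]].
have [y [qy yp]] := dense qp.
suff /lp : C y by rewrite leNgt yp.
rewrite -(maxC (C `|` [set x | q < x <= p])); first by right; rewrite /= qy ltW.
- move=> z [/CA //|/= /andP[qz]]; rewrite le_eqVlt => /orP[/eqP->//|zp].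
  by apply: h; rewrite qz.
- apply: (@convexU _ _ _ _ p) => //; last by rewrite /= qp lexx.
  move=> a b c /= /andP[qa _] /andP[_ cp] ab bc.
  by rewrite (lt_le_trans qa ab) (le_trans bc cp).
- by move=> z; left.
Qed.

Lemma right_inP A p : fci A ->
  right_in A p <-> exists2 q, p < q & forall x, p < x < q -> A x.
Proof.
move=> fA; split=> [[Ap nr]|[q pq h]].
  apply: contrapT => N; apply: nr; apply: right_endpointsI => // x px.
  have [S hS] := fci_tame fA.
  pose m := \big[Order.min/x]_(s <- S | p < s) s.
  have pm : p < m by rewrite /m; elim/big_ind: _ => // a b ap bp; rewrite lt_min ap.
  have mx : m <= x by apply: bigmin_le_id.
  have [|s sS|b hb] := hS [set y | p < y < m].
  - move=> a b c /= /andP[ma _] /andP[_ cp] ab bc.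
    by rewrite (lt_le_trans ma ab) (le_lt_trans bc cp).
  - move=> /= /andP[ps]; apply/negP; rewrite -leNgt; exact: ge_bigmin_seq.
  case: b hb => hb; first by case: N; exists m => // y /hb[_]; apply.
  have [y [py ym]] := dense pm; exists y; first by rewrite py (le_trans (ltW ym) mx).
  by have/= := hb y; rewrite py ym => /(_ isT)[nA _] /nA.
have Ap : A p.
  apply: contrapT => nA; have [r /andP[pr rq] hr] := fci_open_right fA pq nA.
  have [y [py yr]] := dense pr.
  by apply: (hr y); rewrite ?py ?yr//; apply: h; rewrite py (lt_le_trans yr rq).
split=> // -[C [CA cC maxC] [Cp up]].
have [y [py yq]] := dense pq.
suff /up : C y by rewrite leNgt py.
rewrite -(maxC (C `|` [set x | p <= x < q])); first by right; rewrite /= yq ltW.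
- move=> z [/CA //|/= /andP[+ zq]]; rewrite le_eqVlt => /orP[/eqP<-//|pz].
  by apply: h; rewrite pz.
- apply: (@convexU _ _ _ _ p) => //; last by rewrite /= pq lexx.
  move=> a b c /= /andP[qa _] /andP[_ cp] ab bc.
  by rewrite (le_trans qa ab) (le_lt_trans bc cp).
- by move=> z; left.
Qed.

(** A nonempty finite union of closed intervals without a greatest element is unbounded; being
    constant past its last breakpoint, it then contains a final ray. *)
Lemma end_inP A : fci A -> end_in A <-> exists q, forall x, q < x -> A x.
Proof.
move=> fA; split=> [[A0 gA]|[q h]]; last first.
  have [y qy] := nomax q; split; first by exists y; exact: h.
  apply/seteqP; split=> // x [Ax ux].
  have [z mz] := nomax (Order.max x q); move: mz; rewrite gt_max => /andP[xz qz].
  by have /ux := h z qz; rewrite leNgt xz.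
have nb : ~ has_ubound A.
  by move=> /(fci_max nomax fA A0)[x]; rewrite gA => /seteqP[_ /(_ x erefl)].
have [S hS] := fci_tame fA.
pose m := \big[Order.max / \bot]_(s <- S) s.
have [|s sS|b hb] := hS [set y | m < y].
- by move=> a b c /= ma _ ab _; exact: lt_le_trans ma ab.
- by move=> /=; apply/negP; rewrite -leNgt; exact: le_bigmax_seq.
case: b hb => hb; first by exists m => y /hb[_]; apply.
by case: nb; exists m => x Ax; rewrite leNgt; apply/negP => /hb[] /(_ Ax).
Qed.

Definition lletter (U : Type) (u : U -> Pfci I) p : U -> bool :=
  fun i => `[< left_in (sval (u i)) p >].
Definition pletter (U : Type) (u : U -> Pfci I) p : U -> bool :=
  fun i => `[< sval (u i) p >].
Definition rletter (U : Type) (u : U -> Pfci I) p : U -> bool :=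
  fun i => `[< right_in (sval (u i)) p >].
Definition eletter (U : Type) (u : U -> Pfci I) : U -> bool :=
  fun i => `[< end_in (sval (u i)) >].

Lemma letter_glue (U1 U2 : Type) (v : U1 -> Pfci I) (z : U2 -> Pfci I) :
  ((forall p, lletter (glue v z) p = glue (lletter v p) (lletter z p)) *
  (forall p, pletter (glue v z) p = glue (pletter v p) (pletter z p)) *
  (forall p, rletter (glue v z) p = glue (rletter v p) (rletter z p)) *
  (eletter (glue v z) = glue (eletter v) (eletter z)))%type.
Proof. by do !split=> *; apply/funext; case. Qed.

Lemma dense2 p q r : p < r -> q < r -> exists x, [/\ p < x, q < x & x < r].
Proof.
move=> pr qr; have [|x []] := @dense (Order.max p q) r; first by rewrite gt_max pr.
by rewrite gt_max => /andP[px qx] xr; exists x.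
Qed.

Lemma dense2' p q r : p < q -> p < r -> exists x, [/\ p < x, x < q & x < r].
Proof.
move=> pr qr; have [|x [px]] := @dense p (Order.min q r); first by rewrite lt_min pr.
by rewrite lt_min => /andP[xq xr]; exists x.
Qed.

Lemma asbool_eq (P : Prop) (b : bool) : (P <-> b) -> `[< P >] = b.
Proof. by move=> h; apply/asboolP/idP => /h. Qed.

(** * Letters, and induction along the gaps of a family *)

Section Flat.
Context {U : Type}.
Implicit Types (u w : U -> Pfci I) (g h : U -> bool).

Definition flat u p q g := forall i x, p < x -> x < q -> sval (u i) x <-> g i.
Definition flat_end u p g := forall i x, p < x -> sval (u i) x <-> g i.

Lemma flat_sub u p q g p' q' : p <= p' -> q' <= q -> flat u p q g ->
  flat u p' q' g.
Proof.
by move=> pp qq f i x px xq; apply: f; [exact: le_lt_trans px|exact: lt_le_trans qq].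
Qed.

Lemma flat_end_flat u p q g : flat_end u p g -> flat u p q g.
Proof. by move=> f i x px _; exact: f. Qed.

Lemma lletter_sub u p : letter_sub (lletter u p) (pletter u p).
Proof. by move=> i /asboolP[] ? _; exact/asboolP. Qed.

Lemma rletter_sub u p : letter_sub (rletter u p) (pletter u p).
Proof. by move=> i /asboolP[] ? _; exact/asboolP. Qed.

Lemma lletter_agree u w p :
  (forall i x, x < p -> sval (u i) x <-> sval (w i) x) ->
  lletter u p = lletter w p.
Proof.
move=> h; apply/funext => i; apply: asbool_equiv_eq.
have e := left_inP p (svalP (u i)).
have e' := left_inP p (svalP (w i)).
rewrite e e'; split=> -[q qp f]; exists q => // x xpq;
  apply/h; try apply: f => //; by case/andP: xpq.
Qed.

Lemma rletter_agree u w p q : p < q ->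
  (forall i x, p < x < q -> sval (u i) x <-> sval (w i) x) ->
  rletter u p = rletter w p.
Proof.
move=> pq h; apply/funext => i; apply: asbool_equiv_eq.
have e := right_inP p (svalP (u i)).
have e' := right_inP p (svalP (w i)).
rewrite e e'; split=> -[r pr f]; exists (Order.min q r);
  rewrite ?lt_min ?pq// => x /andP[px]; rewrite lt_min => /andP[xq xr].
  by apply/h; [rewrite px|apply: f; rewrite px].
by apply/h; [rewrite px|apply: f; rewrite px].
Qed.

(** The left germ at [x] looks only at points before [x], so [x] may be the right end of the gap;
    [flat_rletter] admits the left end in the same way. *)
Lemma flat_lletter u p q g x : flat u p q g -> p < x -> x <= q ->
  lletter u x = g.
Proof.
move=> f px xq; apply/funext => i; apply: asbool_eq.
rewrite (left_inP _ (svalP (u i))); split=> [[y yx h]|gi].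
  have [z [pz yz zx]] := dense2 px yx.
  by apply/(f i z) => //; [exact: lt_le_trans xq|apply: h; rewrite yz].
by exists p => // y /andP[py yx]; apply/f => //; exact: lt_le_trans xq.
Qed.

Lemma flat_rletter u p q g x : flat u p q g -> p <= x -> x < q ->
  rletter u x = g.
Proof.
move=> f px xq; apply/funext => i; apply: asbool_eq.
rewrite (right_inP _ (svalP (u i))); split=> [[y yx h]|gi].
  have [z [pz yz zx]] := dense2' xq yx.
  apply/(f i z) => //; first exact: le_lt_trans pz.
  by apply: h; rewrite pz.
by exists q => // y /andP[py yx]; apply/f => //; exact: le_lt_trans py.
Qed.

Lemma flat_pletter u p q g x : flat u p q g -> p < x -> x < q ->
  pletter u x = g.
Proof. by move=> f px xq; apply/funext => i; exact/asbool_eq/f. Qed.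

Lemma flat_end_rletter u p g x : flat_end u p g -> p <= x -> rletter u x = g.
Proof.
move=> f px; have [q pq] := nomax x.
exact: flat_rletter (flat_end_flat (q := q) f) px pq.
Qed.

Lemma flat_end_eletter u p g : flat_end u p g -> eletter u = g.
Proof.
move=> f; apply/funext => i; apply: asbool_eq.
rewrite (end_inP (svalP (u i))); split=> [[y h]|gi].
  have [x] := nomax (Order.max y p); rewrite gt_max => /andP[yx px].
  by apply/(f i x px); exact: h.
by exists p => x /f ->.
Qed.

End Flat.

Lemma flat_glue (U1 U2 : Type) (v : U1 -> Pfci I) (z : U2 -> Pfci I) p q g h :
  flat v p q g -> flat z p q h -> flat (glue v z) p q (glue g h).
Proof. by move=> fv fz [] i; [exact: fv|exact: fz]. Qed.

Section Ladder.
Context {U : finType}.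
Implicit Types (u : U -> Pfci I) (g : U -> bool).

Lemma family_tame u : exists S : seq I, forall J, convex J ->
  (forall x, x \in S -> ~ J x) ->
  exists g : U -> bool, forall i x, J x -> sval (u i) x <-> g i.
Proof.
have [S hS] := choice (fun i => fci_tame (svalP (u i))).
exists (flatten [seq S i | i <- enum U]) => J cJ nJ.
have /choice[g hg] : forall i, exists b : bool, forall x, J x -> sval (u i) x <-> b.
  move=> i; apply: hS => // x xS; apply: nJ; apply/flattenP.
  by exists (S i) => //; apply/mapP; exists i => //; rewrite mem_enum.
by exists g.
Qed.

(** This replaces induction on the length of a word: only finitely many breakpoints of the family
    lie between [p] and [q], so crossing one gap at a time reaches [q]. *)
Lemma flat_ladder u (Phi : I -> Prop) p :
  Phi p ->
  (forall q r g, p <= q -> q < r -> flat u q r g -> Phi q -> Phi r) ->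
  forall q, p <= q -> Phi q.
Proof.
move=> Phip step; have [S hS] := family_tame u.
suff H n : forall q r : I, (count (fun s => q < s < r)%O S < n)%N ->
    p <= q -> q < r -> Phi q -> Phi r.
  move=> q; rewrite le_eqVlt => /orP[/eqP<-//|pq].
  by apply: (H _ p q (ltnSn _)).
elim: n => [|n IHn] q r; first by rewrite ltn0.
have [/hasP[s sS /andP[qs sr]]|/hasPn nS] := boolP (has (fun s => q < s < r) S).
  rewrite ltnS => le pq qr Pq.
  (* Splitting at [s] lowers the count, since [s] is counted in the whole interval and in neither
     half. *)
  have lt (a : pred I) : subpred a (fun s => q < s < r) -> ~~ a s -> (count a S < n)%N.
    move=> sub nas; apply: leq_trans le.
    rewrite -addn1; apply: (@leq_trans (count a S + count (pred1 s) S)).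
      by rewrite leq_add2l -has_count; apply/hasP; exists s => //=.
    rewrite -count_predUI (@eq_count _ (predI _ _) pred0) ?count_pred0 ?addn0.
      by apply: sub_count => x /= /orP[/sub//|/eqP->]; rewrite qs.
    by move=> x /=; apply/negP => /andP[ax /eqP xs]; move: nas; rewrite -xs ax.
  have : Phi s.
    apply: (IHn q s) => //; apply: lt; last by rewrite ltxx andbF.
    by move=> x /andP[-> /lt_trans->].
  apply: (IHn s r) => //; last exact: le_trans (ltW qs).
  apply: lt; last by rewrite ltxx.
  by move=> x /andP[/(lt_trans qs)-> ->].
move=> _ pq qr; have [|s /nS/negP//|g hg] := hS [set x | q < x < r].
  move=> a b c /= /andP[qa _] /andP[_ cr] ab bc.
  by rewrite (lt_le_trans qa ab) (le_lt_trans bc cr).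
apply: (step _ _ g) => // i x qx xr; apply: hg.
by rewrite /= qx.
Qed.

Lemma exists_flat_end u : exists p g, flat_end u p g.
Proof.
have [S hS] := family_tame u.
pose m := \big[Order.max / \bot]_(s <- S) s.
have [|s sS|g hg] := hS [set x | m < x].
- by move=> a b c /= ma _ ab _; exact: lt_le_trans ma ab.
- by move=> /=; apply/negP; rewrite -leNgt; exact: le_bigmax_seq.
by exists m, g => i x mx; exact: hg.
Qed.

Lemma exists_flat_right u p : exists q g, p < q /\ flat u p q g.
Proof.
have [S hS] := family_tame u; have [r pr] := nomax p.
pose m := \big[Order.min/r]_(s <- S | p < s) s.
have pm : p < m by rewrite /m; elim/big_ind: _ => // a b ap bp; rewrite lt_min ap.
have [|s sS|g hg] := hS [set x | p < x < m].
- move=> a b c /= /andP[qa _] /andP[_ cr] ab bc.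
  by rewrite (lt_le_trans qa ab) (le_lt_trans bc cr).
- by move=> /= /andP[ps]; apply/negP; rewrite -leNgt; exact: ge_bigmin_seq.
by exists m, g; split=> // i x px xm; apply: hg; rewrite /= px.
Qed.

End Ladder.

(** * Cutting a family at a point and continuing it by a constant letter *)

Section CutExtend.
Context {U : Type}.
Implicit Types (u : U -> Pfci I) (a b g : U -> bool).

Fact cut_extend_fci u p b g i :
  fci ((sval (u i) `&` `]-oo, p]%classic) `|`
    ((if b i then [set p] else set0) `|` (if g i then `[p, +oo[%classic else set0))).
Proof.
apply: fciU; last apply: fciU.
- by apply: fciI; [exact: svalP|apply: fci_interval; constructor 3; exists p].
- by case: ifP => _; [exact: fci1|exact: fci0].
- by case: ifP => _; [apply: fci_interval; constructor 2; exists p|exact: fci0].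
Qed.

Definition cut_extend u p b g : U -> Pfci I :=
  fun i => exist _ _ (cut_extend_fci u p b g i).

Lemma cut_extend_lt u p b g i x : x < p ->
  sval (cut_extend u p b g i) x <-> sval (u i) x.
Proof.
move=> xp; rewrite /= /setU /setI /= in_itv !set_itvE /= (ltW xp).
split=> [[[]//|[|]]|]; last by left.
  by case: ifP => // _ /= e; move: xp; rewrite e ltxx.
by case: ifP => // _; rewrite /= => /le_lt_trans/(_ xp); rewrite ltxx.
Qed.

(** All pieces are closed at [p], so [p] is included as soon as [u] contains it or [g] holds; the
    hypotheses make [b] absorb both contributions. *)
Lemma cut_extend_eq u p b g i : letter_sub (pletter u p) b -> letter_sub g b ->
  sval (cut_extend u p b g i) p <-> b i.
Proof.
move=> ub gb; rewrite /= /setU /setI /= in_itv !set_itvE /= lexx.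
split=> [[[up _]|[|]]|->]; last by right; left.
- by apply: ub; exact/asboolP.
- by case: ifP.
- by case: ifP => // /gb.
Qed.

Lemma cut_extend_flat_end u p b g : flat_end (cut_extend u p b g) p g.
Proof.
move=> i x px; rewrite /= /setU /setI /= in_itv !set_itvE /= leNgt px.
split=> [[[]//|[|]]|->]; last by right; right; rewrite /= ltW.
  by case: ifP => // _ /= e; move: px; rewrite e ltxx.
by case: ifP.
Qed.

Lemma cut_extend_letters u p b g x : x < p ->
  ((lletter (cut_extend u p b g) x = lletter u x) *
   (pletter (cut_extend u p b g) x = pletter u x) *
   (rletter (cut_extend u p b g) x = rletter u x))%type.
Proof.
move=> xp; do !split.
- by apply: lletter_agree => i y yx; apply: cut_extend_lt; exact: lt_trans xp.
- by apply/funext => i; apply: asbool_equiv_eq; exact: cut_extend_lt.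
- apply: (rletter_agree xp) => i y /andP[_ yp]; exact: cut_extend_lt.
Qed.

Lemma cut_extend_letters_at u p b g : letter_sub (pletter u p) b -> letter_sub g b ->
  ((lletter (cut_extend u p b g) p = lletter u p) *
   (pletter (cut_extend u p b g) p = b) *
   (rletter (cut_extend u p b g) p = g))%type.
Proof.
move=> ub gb; do !split.
- by apply: lletter_agree => i y yx; exact: cut_extend_lt.
- by apply/funext => i; apply: asbool_eq; exact: cut_extend_eq.
- exact: flat_end_rletter (@cut_extend_flat_end u p b g) (lexx p).
Qed.

Definition empty_family : U -> Pfci I := fun=> exist _ _ fci0.

Lemma empty_family_letters p :
  ((lletter empty_family p = fun=> false) *
   (pletter empty_family p = fun=> false))%type.
Proof. by split; apply/funext => i; apply/asboolP; [case|]. Qed.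

End CutExtend.

(** * Local relations and their projections *)

Definition allowed (U : Type)
    (D : bool -> (U -> bool) -> (U -> bool) -> (U -> bool) -> Prop)
    (u : U -> Pfci I) p :=
  D (p == \bot) (lletter u p) (pletter u p) (rletter u p).

Definition local_rel (U : Type)
    (D : bool -> (U -> bool) -> (U -> bool) -> (U -> bool) -> Prop)
    (F : (U -> bool) -> Prop) (u : U -> Pfci I) :=
  (forall p, allowed D u p) /\ F (eletter u).

(** [W] indexes the sets projected away. [D] and [F] are arbitrary predicates, which is harmless
    because there are only finitely many letters. *)
Definition recognizable (V : finType) (R : (V -> Pfci I) -> Prop) :=
  exists (W : finType) D F, forall v,
    R v <-> exists z : W -> Pfci I, local_rel D F (glue v z).

(** * The subset construction *)

Section Complement.
Variables (V W : finType).
Variable D : bool -> (V + W -> bool) -> (V + W -> bool) -> (V + W -> bool) -> Prop.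
Variable F : (V + W -> bool) -> Prop.
Implicit Types (v : V -> Pfci I) (Z : W -> Pfci I) (Y : {ffun W -> bool} -> Pfci I).
Implicit Types (z c : W -> bool) (P : {ffun W -> bool} -> bool) (g : V -> bool).

(** The tile condition at an interior point of a gap: the left, point and right letters agree there,
    and the point is not 0. *)
Let admissible g z := D false (glue g z) (glue g z) (glue g z).

(* Right germs of the auxiliary sets possible after a point with point letter
   [a] and right germ [gr], when [P] is the set of possible left germs.  Further
   breakpoints of the auxiliary sets may occur inside the gap that follows
   ([reach_move]); this closure makes [delta] idempotent on gaps, so that its
   value does not depend on how the gaps are subdivided. *)
Inductive reach (b : bool) P gl a gr : (W -> bool) -> Prop :=
| reach_jump z0 c z :
    (if b then z0 = (fun=> false) else P (finfun z0)) ->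
    letter_sub z0 c -> letter_sub z c ->
    D b (glue gl z0) (glue a c) (glue gr z) -> admissible gr z ->
    reach b P gl a gr z
| reach_move z0 c z : reach b P gl a gr z0 ->
    letter_sub z0 c -> letter_sub z c ->
    D false (glue gr z0) (glue gr c) (glue gr z) -> admissible gr z ->
    reach b P gl a gr z.

Definition delta b P gl a gr : {ffun W -> bool} -> bool :=
  fun w => `[< reach b P gl a gr w >].

Lemma delta_finfun b P gl a gr z :
  delta b P gl a gr (finfun z) <-> reach b P gl a gr z.
Proof.
rewrite /delta (_ : (finfun z : W -> bool) = z); last first.
  by apply/funext => i; rewrite ffunE.
by split=> /asboolP.
Qed.

(** In one direction every jump from an already reached germ is a [reach_move]; in the other, a
    reached germ is admissible and therefore jumps to itself. *)
Lemma delta_idem b P gl a g :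
  delta false (delta b P gl a g) g g g = delta b P gl a g.
Proof.
apply/funext => z; apply: asbool_equiv_eq; split.
  elim=> [z0 c z1 /delta_finfun r0 s0 s1 D1 v1|z0 c z1 _ r0 s0 s1 D1 v1].
    exact: reach_move r0 s0 s1 D1 v1.
  exact: reach_move r0 s0 s1 D1 v1.
move=> r; have az : admissible g z by case: r.
apply: (reach_jump (z0 := z) (c := z)) => //.
exact/delta_finfun.
Qed.

(* A state is a set of letters over [W], hence a letter over the variables
   [{ffun W -> bool}]: the right germ of the state sets codes the current state,
   and their point letters are unconstrained. *)
Definition det_rel b (l m r : V + {ffun W -> bool} -> bool) : Prop :=
  r \o inr = delta b (l \o inr) (l \o inl) (m \o inl) (r \o inl).

(** Every germ still possible at infinity has to be rejected by [F]. *)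
Definition det_end (e : V + {ffun W -> bool} -> bool) : Prop :=
  forall z, e (inr (finfun z)) -> ~ F (glue (e \o inl) z).

Lemma allowed_det v Y p : allowed det_rel (glue v Y) p <->
  rletter Y p = delta (p == \bot) (lletter Y p) (lletter v p) (pletter v p) (rletter v p).
Proof. by rewrite /allowed !letter_glue. Qed.

(** Inside the gap the prescribed state is [delta] applied to the current state, and [delta_idem]
    says that it does not change. *)
Lemma allowed_det_gap v Y p q x g : allowed det_rel (glue v Y) p ->
  flat v p q g -> flat Y p q (rletter Y p) -> p < x -> x < q ->
  allowed det_rel (glue v Y) x.
Proof.
move=> /allowed_det yp fv fy px xq; apply/allowed_det.
have pq := lt_trans px xq.
rewrite (gt_eqF (le_lt_trans (le0x p) px)).
rewrite (flat_lletter fv px (ltW xq)) (flat_pletter fv px xq).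
rewrite (flat_rletter fv (ltW px) xq).
rewrite (flat_lletter fy px (ltW xq)) (flat_rletter fy (ltW px) xq).
rewrite yp -(flat_rletter fv (lexx p) pq).
by rewrite delta_idem.
Qed.

(** The subset construction is total and deterministic, so its run on [v] is built from left to
    right, with a cut at the end of each gap of [v]. *)
Lemma det_exists v : exists Y, forall p, allowed det_rel (glue v Y) p.
Proof.
(* [Y] is correct up to [p] and constant afterwards, ready for the next cut. *)
pose Phi p := exists Y, (forall q, q <= p -> allowed det_rel (glue v Y) q) /\
  flat_end Y p (rletter Y p).
suff step q Y : pletter Y q = lletter Y q ->
    (forall x, x < q -> allowed det_rel (glue v Y) x) -> Phi q.
  have H p : Phi p.
    apply: (@flat_ladder _ v Phi \bot); last exact: le0x.
      apply: (step _ empty_family) => [|x]; last by rewrite ltx0.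
      by rewrite !empty_family_letters.
    move=> p' q g _ pq fv [Y [yp fy]]; apply: (step _ Y) => [|x xq].
      have [r qr] := nomax q.
      have f := flat_end_flat (q := r) fy.
      by rewrite (flat_lletter f pq (ltW qr)) (flat_pletter f pq qr).
    have [/yp//|px] := leP x p'.
    exact: (allowed_det_gap (yp _ (lexx _)) fv (flat_end_flat fy)).
  have [p [g fv]] := exists_flat_end v; have [Y [yp fy]] := H p.
  exists Y => x; have [/yp//|px] := leP x p; have [q xq] := nomax x.
  exact: (allowed_det_gap (yp _ (lexx _)) (flat_end_flat fv) (flat_end_flat fy) px xq).
move=> yq hy.
pose g := delta (q == \bot) (lletter Y q) (lletter v q) (pletter v q) (rletter v q).
(* The least point letter compatible with both side germs, as closedness requires. *)
pose b k := lletter Y q k || g k.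
have yb : letter_sub (pletter Y q) b by move=> k; rewrite yq /b => ->.
have gb : letter_sub g b by move=> k; rewrite /b orbC => ->.
exists (cut_extend Y q b g); split; last first.
  by rewrite (cut_extend_letters_at yb gb); exact: cut_extend_flat_end.
move=> x; rewrite le_eqVlt => /orP[/eqP->|xq].
  by apply/allowed_det; rewrite !(cut_extend_letters_at yb gb).
by have /allowed_det := hy x xq; rewrite allowed_det !cut_extend_letters.
Qed.

(** Just after [p] the families are constant on a gap, and by density the tile condition can be read
    at a point inside it. *)
Lemma allowed_admissible v Z p :
  (forall q, allowed D (glue v Z) q) -> admissible (rletter v p) (rletter Z p).
Proof.
move=> h; have [q [g [pq f]]] := exists_flat_right (glue v Z) p.
have [x [px xq]] := dense pq; have := h x.
rewrite /allowed (gt_eqF (le_lt_trans (le0x p) px)) /admissible -letter_glue.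
rewrite (flat_lletter f px (ltW xq)) (flat_pletter f px xq).
by rewrite (flat_rletter f (ltW px) xq) (flat_rletter f (lexx p) pq).
Qed.

(** The right germ of a solution [Z] belongs, at every point, to the state coded by [Y]: the actual
    letters of [Z] at the point provide a [reach_jump]. *)
Lemma det_sound v Y Z : (forall p, allowed det_rel (glue v Y) p) ->
  (forall p, allowed D (glue v Z) p) -> eletter Y (finfun (eletter Z)).
Proof.
move=> hy hZ; pose Phi p := rletter Y p (finfun (rletter Z p)).
have step p : (if p == \bot then lletter Z p = fun=> false
    else lletter Y p (finfun (lletter Z p))) -> Phi p.
  move=> hp; rewrite /Phi; have /allowed_det -> := hy p; apply/delta_finfun.
  have := hZ p; rewrite /allowed !letter_glue => Dp.
  apply: reach_jump Dp _ => //; first exact: lletter_sub.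
    exact: rletter_sub.
  exact: allowed_admissible.
have H p : Phi p.
  apply: (@flat_ladder _ (glue Y Z) Phi \bot); last exact: le0x.
    apply: step; rewrite eqxx; apply/funext => i; apply/asboolP.
    by move=> /(left_inP _ (svalP (Z i)))[q]; rewrite ltx0.
  move=> q r g _ qr f; have fy : flat Y q r _ := fun i => f (inl i).
  have fZ : flat Z q r _ := fun i => f (inr i).
  rewrite /Phi (flat_rletter fy (lexx q) qr) (flat_rletter fZ (lexx q) qr) => hg.
  apply: step; rewrite (gt_eqF (le_lt_trans (le0x q) qr)).
  by rewrite (flat_lletter fy qr (lexx r)) (flat_lletter fZ qr (lexx r)).
have [p [g f]] := exists_flat_end (glue Y Z).
have fy : flat_end Y p _ := fun i => f (inl i).
have fZ : flat_end Z p _ := fun i => f (inr i).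
have := H p; rewrite /Phi (flat_end_rletter fy (lexx p)) (flat_end_rletter fZ (lexx p)).
by rewrite (flat_end_eletter fy) (flat_end_eletter fZ).
Qed.

Lemma allowed_gap v Z p q g z : (forall x, x <= p -> allowed D (glue v Z) x) ->
  flat v p q g -> flat_end Z p z -> admissible g z ->
  forall x, x < q -> allowed D (glue v Z) x.
Proof.
move=> hZ fv fZ ad x xq; have [/hZ//|px] := leP x p.
have f := flat_glue fv (flat_end_flat fZ (q := q)).
rewrite /allowed (gt_eqF (le_lt_trans (le0x p) px)).
by rewrite (flat_lletter f px (ltW xq)) (flat_pletter f px xq)
           (flat_rletter f (ltW px) xq).
Qed.

Lemma allowed_extend v Z q c z : (forall x, x < q -> allowed D (glue v Z) x) ->
  letter_sub (pletter Z q) c -> letter_sub z c ->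
  D (q == \bot) (glue (lletter v q) (lletter Z q)) (glue (pletter v q) c)
    (glue (rletter v q) z) ->
  forall x, x <= q -> allowed D (glue v (cut_extend Z q c z)) x.
Proof.
move=> hZ sZ sz Dq x; rewrite le_eqVlt => /orP[/eqP->|xq].
  by rewrite /allowed !letter_glue !(cut_extend_letters_at sZ sz).
by have := hZ x xq; rewrite /allowed !letter_glue !cut_extend_letters.
Qed.

(** A reached germ comes from actual sets: the jump is a cut at [q], and each move is a further cut
    inside the gap. Stopping strictly before [r] leaves room for more moves. *)
Lemma reach_realize v q r P : q < r -> flat v q r (rletter v q) ->
  (forall z0, (if q == \bot then z0 = (fun=> false) else P (finfun z0)) ->
     exists Z, [/\ forall x, x < q -> allowed D (glue v Z) x,
       lletter Z q = z0 & pletter Z q = z0]) ->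
  forall z, reach (q == \bot) P (lletter v q) (pletter v q) (rletter v q) z ->
  exists Z p, [/\ q <= p, p < r, forall x, x <= p -> allowed D (glue v Z) x &
    flat_end Z p z].
Proof.
move=> qr fv base z; elim=> [z0 c z1 /base[Z [hZ lZ pZ]] s0 s1 Dq ad|
    z0 c z1 rz0 [Z [p [qp pr hZ fZ]]] s0 s1 D1 ad].
  exists (cut_extend Z q c z1), q; split=> //; last exact: cut_extend_flat_end.
  by apply: allowed_extend; rewrite ?lZ ?pZ.
have ad0 : admissible (rletter v q) z0 by case: rz0.
have [s [ps sr]] := dense pr; have qs := le_lt_trans qp ps.
have f := flat_end_flat (q := r) fZ.
exists (cut_extend Z s c z1), s; split=> //; first exact: ltW.
  apply: allowed_extend; rewrite ?(flat_pletter f ps sr) ?(flat_lletter f ps (ltW sr)) //.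
    exact: (allowed_gap hZ (flat_sub qp (ltW sr) fv) fZ ad0).
  rewrite (gt_eqF (le_lt_trans (le0x q) qs)) (flat_lletter fv qs (ltW sr)).
  by rewrite (flat_pletter fv qs sr) (flat_rletter fv (ltW qs) sr).
exact: cut_extend_flat_end.
Qed.

(** Converse of [det_sound]: any germ in the final state is the end of a solution, obtained by
    realizing the states gap after gap. *)
Lemma det_complete v Y z : (forall p, allowed det_rel (glue v Y) p) ->
  eletter Y (finfun z) ->
  exists Z, (forall p, allowed D (glue v Z) p) /\ eletter Z = z.
Proof.
move=> hy yz.
(* Every germ in the state after [p] is realized by a family that settles before any prescribed [q],
   hence before the current gap ends. *)
pose Phi p := forall q, p < q -> flat v p q (rletter v p) ->
  forall z, rletter Y p (finfun z) -> exists Z r,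
  [/\ p <= r, r < q, forall x, x <= r -> allowed D (glue v Z) x & flat_end Z r z].
have adm p z1 : rletter Y p (finfun z1) -> admissible (rletter v p) z1.
  by have /allowed_det -> := hy p; move=> /delta_finfun; case.
have H p : Phi p.
  apply: (@flat_ladder _ (glue v Y) Phi \bot); last exact: le0x.
    move=> q bq fv z1; have /allowed_det -> := hy \bot; move=> /delta_finfun.
    apply: reach_realize => //; rewrite eqxx => _ ->.
    exists empty_family; rewrite !empty_family_letters; split=> // x.
    by rewrite ltx0.
  move=> q r g _ qr f Hq s rs fv z1.
  have fv' : flat v q r _ := fun i => f (inl i).
  have fy : flat Y q r _ := fun i => f (inr i).
  have /allowed_det -> := hy r; move=> /delta_finfun.
  apply: reach_realize => // z0.
  have -> : lletter Y r = rletter Y q.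
    by rewrite (flat_lletter fy qr (lexx r)) (flat_rletter fy (lexx q) qr).
  rewrite (gt_eqF (le_lt_trans (le0x q) qr)) => yz0.
  have {}fv' : flat v q r (rletter v q) by rewrite (flat_rletter fv' (lexx q) qr).
  have [Z [p' [qp pr hZ fZ]]] := Hq r qr fv' _ yz0.
  have fZ' := flat_end_flat (q := s) fZ.
  exists Z; rewrite (flat_lletter fZ' pr (ltW rs)) (flat_pletter fZ' pr rs).
  split=> //; apply: (allowed_gap hZ (flat_sub qp (lexx r) fv') fZ).
  exact: adm.
have [p [g f]] := exists_flat_end (glue v Y).
have fv : flat_end v p _ := fun i => f (inl i).
have fy : flat_end Y p _ := fun i => f (inr i).
have {}fv : flat_end v p (rletter v p) by rewrite (flat_end_rletter fv (lexx p)).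
have {}yz : rletter Y p (finfun z).
  by move: yz; rewrite (flat_end_eletter fy) (flat_end_rletter fy (lexx p)).
have [q pq] := nomax p.
have [Z [r [pr rq hZ fZ]]] := H p q pq (flat_end_flat fv) _ yz.
exists Z; rewrite (flat_end_eletter fZ); split=> // x.
have [s] := nomax x.
apply: (allowed_gap hZ (flat_sub pr (lexx s) (flat_end_flat fv)) fZ).
exact: adm.
Qed.

Lemma complement_local v : ~ (exists Z, local_rel D F (glue v Z)) <->
  exists Y, local_rel det_rel det_end (glue v Y).
Proof.
split=> [N|[Y [hy ey]] [Z [hZ eZ]]].
  have [Y hy] := det_exists v; exists Y; split=> // z; rewrite letter_glue /= => yz Fz.
  have [Z [hZ Zz]] := det_complete hy yz.
  by apply: N; exists Z; split=> //; rewrite letter_glue Zz.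
move: ey eZ; rewrite !letter_glue => /(_ (eletter Z)); apply.
exact: det_sound hy hZ.
Qed.

End Complement.

Lemma recognizableC (V : finType) (R : (V -> Pfci I) -> Prop) :
  recognizable R -> recognizable (fun v => ~ R v).
Proof.
move=> [W [D [F h]]]; exists {ffun W -> bool}, (det_rel D), (det_end F) => v.
by rewrite h; exact: complement_local.
Qed.

(** * Recognizable relations *)

Section Closure.
Implicit Types (V X : finType).

Lemma recognizable_ext V (R R' : (V -> Pfci I) -> Prop) :
  (forall v, R v <-> R' v) -> recognizable R -> recognizable R'.
Proof. by move=> e [W [D [F h]]]; exists W, D, F => v; rewrite -e. Qed.

Lemma recognizable_local V D F : recognizable (@local_rel V D F).
Proof.
exists void, (fun b l m n => D b (l \o inl) (m \o inl) (n \o inl)).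
exists (fun e => F (e \o inl)) => v; split=> [h|[z]]; last exact.
by exists (fun x : void => match x with end).
Qed.

Lemma recognizable_pointwise V (R : (V -> Pfci I) -> Prop) D :
  (forall u, R u <-> forall p, allowed D u p) -> recognizable R.
Proof.
move=> h; apply: recognizable_ext (recognizable_local D (fun=> True)) => v.
by rewrite h; split=> [[]|].
Qed.

Lemma recognizable_reindex V V' (f : V -> V') (R : (V -> Pfci I) -> Prop) :
  recognizable R -> recognizable (fun v => R (v \o f)).
Proof.
move=> [W [D [F h]]].
pose k (x : V + W) : V' + W := match x with inl i => inl (f i) | inr j => inr j end.
exists W, (fun b l m n => D b (l \o k) (m \o k) (n \o k)), (fun e => F (e \o k)) => v.
rewrite h; suff e z : glue (v \o f) z = glue v z \o k.
  by split=> -[z hz]; exists z; move: hz; rewrite e.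
by apply/funext; case.
Qed.

(** Projections compose: the quantified sets join the auxiliary ones. *)
Lemma recognizable_ex V X (R : (V + X -> Pfci I) -> Prop) :
  recognizable R -> recognizable (fun v => exists x : X -> Pfci I, R (glue v x)).
Proof.
move=> [W [D [F h]]].
pose k (x : (V + X) + W) : V + (X + W) :=
  match x with inl (inl i) => inl i | inl (inr j) => inr (inl j) | inr w => inr (inr w) end.
exists (X + W)%type, (fun b l m n => D b (l \o k) (m \o k) (n \o k)), (fun e => F (e \o k)) => v.
have e (x : X -> Pfci I) (z : W -> Pfci I) : glue (glue v x) z = glue v (glue x z) \o k.
  by apply/funext; case=> [[]|].
split=> [[x /h[z]]|[z]]; first by rewrite e; exists (glue x z).
by rewrite (glueE z) => hz; exists (z \o inl); apply/h; exists (z \o inr); rewrite e.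
Qed.

Lemma recognizableI V (R R' : (V -> Pfci I) -> Prop) :
  recognizable R -> recognizable R' -> recognizable (fun v => R v /\ R' v).
Proof.
move=> [W [D [F h]]] [W' [D' [F' h']]].
pose k (x : V + W) : V + (W + W') := match x with inl i => inl i | inr j => inr (inl j) end.
pose k' (x : V + W') : V + (W + W') := match x with inl i => inl i | inr j => inr (inr j) end.
exists (W + W')%type.
exists (fun b l m n => D b (l \o k) (m \o k) (n \o k) /\ D' b (l \o k') (m \o k') (n \o k')).
exists (fun e => F (e \o k) /\ F' (e \o k')) => v; rewrite h h'.
have e z z' : glue v z = glue v (glue z z') \o k by apply/funext; case.
have e' z z' : glue v z' = glue v (glue z z') \o k' by apply/funext; case.
split=> [[[z +] [z']]|[z]].
  rewrite (e z z') (e' z z') => -[a b] [a' b']; exists (glue z z').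
  by do !split=> //; [exact: a | exact: a'].
rewrite (glueE z) => -[a [b b']]; split; [exists (z \o inl)|exists (z \o inr)].
  by rewrite (e _ (z \o inr)); split=> // p; case: (a p).
by rewrite (e' (z \o inl)); split=> // p; case: (a p).
Qed.

Lemma recognizable_all V (K : finType) (R : K -> (V -> Pfci I) -> Prop) :
  (forall k, recognizable (R k)) -> recognizable (fun v => forall k, R k v).
Proof.
move=> h; suff H (s : seq K) : recognizable (fun v => forall k, k \in s -> R k v).
  apply: recognizable_ext (H (enum K)) => v.
  by split=> Rv k => [|_]; apply: Rv; rewrite ?mem_enum.
elim: s => [|k s IHs].
  by apply: (@recognizable_pointwise _ _ (fun _ _ _ _ => True)).
apply: recognizable_ext (recognizableI (h k) IHs) => v; split=> [[Rk Rs] k'|Rv].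
  by rewrite inE => /orP[/eqP->//|]; exact: Rs.
by split=> [|k' k's]; apply: Rv; rewrite inE ?eqxx ?k's ?orbT.
Qed.

Definition ocons V a (v : V -> Pfci I) (o : option V) : Pfci I :=
  if o is Some i then v i else a.

Lemma recognizable_ex1 V (R : (option V -> Pfci I) -> Prop) :
  recognizable R -> recognizable (fun v => exists a, R (ocons a v)).
Proof.
pose f (o : option V) : V + unit := if o is Some i then inl i else inr tt.
move=> /(recognizable_reindex f)/recognizable_ex; apply: recognizable_ext => v.
have e (x : unit -> Pfci I) : glue v x \o f = ocons (x tt) v by apply/funext; case.
by split=> [[x]|[a]]; [rewrite e; exists (x tt)|exists (fun=> a); rewrite e].
Qed.

Lemma recognizable_imply V (R R' : (V -> Pfci I) -> Prop) :
  recognizable R -> recognizable R' -> recognizable (fun v => R v -> R' v).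
Proof.
move=> h /recognizableC h'.
apply: recognizable_ext (recognizableC (recognizableI h h')) => v.
by rewrite not_andP not_notE implyE.
Qed.

Lemma recognizableU V (R R' : (V -> Pfci I) -> Prop) :
  recognizable R -> recognizable R' -> recognizable (fun v => R v \/ R' v).
Proof.
move=> /recognizableC h h'.
apply: recognizable_ext (recognizable_imply h h') => v.
by rewrite implyE not_notE.
Qed.

Lemma recognizable_all1 V (R : (option V -> Pfci I) -> Prop) :
  recognizable R -> recognizable (fun v => forall a, R (ocons a v)).
Proof.
move=> /recognizableC/recognizable_ex1/recognizableC.
apply: recognizable_ext => v; rewrite -forallNP.
by split=> h a; move: (h a); rewrite not_notE.
Qed.

Lemma recognizable_sub V (i j : V) :
  recognizable (fun u => sval (u i) `<=` sval (u j)).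
Proof.
apply: (@recognizable_pointwise _ _ (fun _ _ m _ => m i -> m j)) => u.
by split=> h p; [move=> /asboolP/h/asboolP|move=> /asboolP/(h p)/asboolP].
Qed.

Definition all_below (A B : set I) := forall a b, A a -> B b -> a <= b.

(* [A] lies below [B] iff some closed initial segment contains [A] and has no
   point of [B] immediately followed by points of the segment. *)
Lemma recognizable_all_below V (i j : V) :
  recognizable (fun u => all_below (sval (u i)) (sval (u j))).
Proof.
(* Index [None] is the segment. By the first clause each of its points other than 0 has points of
   the segment immediately before it, which makes it initial. *)
pose D b (l m n : option V -> bool) := [/\ m None -> b || l None,
  m (Some i) -> m None & m (Some j) -> ~~ n None].
have := recognizable_ex1 (recognizable_local D (fun=> True)).
apply: recognizable_ext => u; split=> [[S [hS _]] a b Aa Bb|AB].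
  rewrite leNgt; apply/negP => ba.
  (* The segment stops at [b] and cannot resume: a later point of it would need a left germ. *)
  pose Phi p := (b < p -> ~~ pletter (ocons S u) p None) /\
    ~~ rletter (ocons S u) p None.
  have [|q r g bq qr f [_ hq]|/(_ ba)/asboolP + _] :=
    @flat_ladder _ (ocons S u) Phi b _ _ a (ltW ba).
  - by split; [rewrite ltxx|case: (hS b) => _ _; apply; apply/asboolP].
  - suff h : ~~ pletter (ocons S u) r None.
      by split=> //; apply: contra h; exact: rletter_sub.
    case: (hS r) => + _ _; apply: contraPN => /[swap] /[apply].
    rewrite (gt_eqF (le_lt_trans (le0x q) qr)) /= (flat_lletter f qr (lexx r)).
    by rewrite -(flat_rletter f (lexx q) qr); exact/negP.
  - by case: (hS a) => _ + _; move=> /(_ _)/asboolP h; apply; apply: h; exact/asboolP.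
(* The segment is the set of lower bounds: the whole line if the second set is empty, and otherwise
   the interval from 0 to its minimum. *)
have [S SE] : exists S : Pfci I, sval S = lbound (sval (u j)).
  have [B0|/set0P B0] := eqVneq (sval (u j)) set0.
    exists (exist _ _ (fci_interval (Or32 _ _ (ex_intro _ \bot erefl)))).
    by rewrite B0 /= set_itvE; apply/seteqP; split=> [x _ y []|x _]; exact: le0x.
  have [m mE] := fci_min (svalP (u j)) B0.
  have [Bm lm] : least (sval (u j)) m by rewrite mE.
  exists (exist _ _ (fci_interval (Or31 _ _ (ex_intro _ \bot (ex_intro _ m erefl))))).
  rewrite /= set_itvE; apply/seteqP; split=> x /=; rewrite le0x /=.
    by move=> xm y /lm; exact: le_trans.
  exact.
exists S; split=> // p; split.
- rewrite /pletter /lletter /= => /asboolP Sp.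
  have [//|p0] := eqVneq p \bot; apply/asboolP.
  apply/(left_inP _ (svalP S)); exists \bot; first by rewrite lt0x.
  move=> x /andP[_ xp]; move: Sp; rewrite SE => Sp y /Sp.
  by apply: le_trans; exact: ltW.
- by rewrite /pletter /= => /asboolP Ap; apply/asboolP; rewrite SE => y; exact: AB.
- rewrite /pletter /rletter /= => /asboolP Bp; apply/asboolP.
  move=> /(right_inP _ (svalP S))[q pq]; have [x [px xq]] := dense pq.
  move=> /(_ x); rewrite px xq SE => /(_ isT _ Bp).
  by rewrite leNgt px.
Qed.

End Closure.

(** * Recognizability of the symbols, terms and formulas *)

Lemma Pfci_eq (A B : Pfci I) : A = B <-> forall p, sval A p <-> sval B p.
Proof.
split=> [->//|]; case: A B => [A fA] [B fB] /= h.
by apply: eq_exist; apply/seteqP; split=> p /h.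
Qed.

Lemma Pfci_sval_eq (A B : Pfci I) : A = B <-> sval A = sval B.
Proof. by split=> [->//|h]; apply/Pfci_eq => p; rewrite h. Qed.

(** Meant for [min] and [max], whose graphs compare distant points. [f A] is the largest subset of
    [A] in relation [Q] to [A]; since [Q] is tested pointwise, singletons detect maximality. *)
Lemma recognizable_select (Q : set I -> set I -> Prop) (f : set I -> set I)
    (V : finType) (k i : V) :
  (forall (V' : finType) (k' i' : V'),
    recognizable (fun u => Q (sval (u k')) (sval (u i')))) ->
  (forall A B, Q A B <-> forall p, A p -> Q [set p] B) ->
  (forall A p, f A p <-> A p /\ Q [set p] A) ->
  recognizable (fun u => sval (u k) = f (sval (u i))).
Proof.
move=> recQ Qp fp.
have := recognizableI (recognizableI (recognizable_sub k i) (recQ V k i))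
  (recognizable_all1 (recognizable_imply
    (recognizableI (recognizable_sub None (Some i)) (recQ _ None (Some i)))
    (recognizable_sub None (Some k)))).
apply: recognizable_ext => u /=; split.
  move=> [[ki /Qp kQ] h]; apply/seteqP; split=> p.
    by move=> kp; apply/fp; split; [exact: ki|exact: kQ].
  move=> /fp[ip Qip]; have := h (exist _ _ (fci1 p)) _ p; apply=> //=.
  by split=> // q ->.
move=> ->; split; first split; first by move=> p /fp[].
  by apply/Qp => p /fp[].
by move=> X [Xi /Qp XQ] p Xp; apply/fp; split; [exact: Xi|exact: XQ].
Qed.

Lemma recognizable_least (V : finType) (k i : V) :
  recognizable (fun u => sval (u k) = least (sval (u i))).
Proof.
apply: (@recognizable_select all_below) => [V' k' i'|A B|A p].
- exact: recognizable_all_below.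
- by split=> [h p Ap a b ->|h a b /h]; [exact: h|apply].
- by split=> -[Ap h]; split=> //; [move=> a b ->; exact: h|move=> b; exact: h].
Qed.

Lemma recognizable_greatest (V : finType) (k i : V) :
  recognizable (fun u => sval (u k) = greatest (sval (u i))).
Proof.
apply: (@recognizable_select (fun A B => all_below B A)) => [V' k' i'|A B|A p].
- exact: recognizable_all_below.
- by split=> [h p Ap a b /h + ->|h a b Ba /h]; [apply|apply].
- by split=> -[Ap h]; split=> //; [move=> a b Aa ->; exact: h|move=> b Ab; exact: h].
Qed.

Lemma asbool_iff (P Q : Prop) : (P <-> Q) <-> `[< P >] = `[< Q >].
Proof.
split=> [|e]; first exact: asbool_equiv_eq.
by split=> /asboolP h; apply/asboolP; rewrite ?e// -e.
Qed.

(** Except for [min] and [max], a condition at each point suffices; for [l] and [r], an endpoint is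
    a point of the set where the corresponding germ fails. *)
Lemma recognizable_graph (f : LL) :
  recognizable (fun u : option 'I_(arity f) -> Pfci I =>
    u None = LI_interp (u \o Some)).
Proof.
have PW (P : (option 'I_(arity f) -> Pfci I) -> I -> Prop) D :
    (forall u p, P u p <-> sval (LI_interp (u \o Some)) p) ->
    (forall u p, (sval (u None) p <-> P u p) <-> allowed D u p) ->
    recognizable (fun u : option 'I_(arity f) -> Pfci I =>
      u None = LI_interp (u \o Some)).
  move=> hP hD; apply: (@recognizable_pointwise _ _ D) => u; rewrite Pfci_eq.
  by split=> h p; [apply/hD; rewrite hP|rewrite -hP; apply/hD].
case: f PW => PW.
- apply: (PW (fun u p => sval (u (Some ord0)) p \/ sval (u (Some ord_max)) p)
    (fun _ _ m _ => m None = m (Some ord0) || m (Some ord_max))) => // u p.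
  rewrite /allowed /pletter -asbool_or; exact: asbool_iff.
- apply: (PW (fun u p => sval (u (Some ord0)) p /\ sval (u (Some ord_max)) p)
    (fun _ _ m _ => m None = m (Some ord0) && m (Some ord_max))) => // u p.
  rewrite /allowed /pletter -asbool_and; exact: asbool_iff.
- apply: (PW (fun u p => False) (fun _ _ m _ => m None = false)) => // u p.
  rewrite /allowed /pletter.
  by rewrite -(asboolF (@id False)); exact: asbool_iff.
- apply: (PW (fun u p => p = \bot) (fun b _ m _ => m None = b)) => // u p.
  rewrite /allowed /pletter -(@asbool_eq (p = \bot) (p == \bot)); last by split=> /eqP.
  exact: asbool_iff.
- have := recognizable_least None (Some ord0 : option 'I_1).
  by apply: recognizable_ext => u; rewrite Pfci_eq /=; split=> [->|h] //; apply/seteqP; split=> p /h.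
- have := recognizable_greatest None (Some ord0 : option 'I_1).
  by apply: recognizable_ext => u; rewrite Pfci_eq /=; split=> [->|h] //; apply/seteqP; split=> p /h.
- apply: (PW (fun u p => sval (u (Some ord0)) p /\ ~ left_in (sval (u (Some ord0))) p)
    (fun _ l m _ => m None = m (Some ord0) && ~~ l (Some ord0))) => u p.
    rewrite /= /left_in; split=> [[Ap h]|h].
      by apply: contrapT => h'; apply: h.
    by split=> [|[]//]; exact: left_endpoints_sub.
  rewrite /allowed /pletter /lletter -asbool_neg -asbool_and.
  exact: asbool_iff.
- apply: (PW (fun u p => sval (u (Some ord0)) p /\ ~ right_in (sval (u (Some ord0))) p)
    (fun _ _ m n => m None = m (Some ord0) && ~~ n (Some ord0))) => u p.
    rewrite /= /right_in; split=> [[Ap h]|h].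
      by apply: contrapT => h'; apply: h.
    by split=> [|[]//]; exact: right_endpoints_sub.
  rewrite /allowed /pletter /rletter -asbool_neg -asbool_and.
  exact: asbool_iff.
Qed.

(** Index [None] holds the value of the term. In an application the values of the arguments are
    quantified and then fed to the graph of the symbol. *)
Lemma recognizable_eval n (t : term LL n) :
  recognizable (fun u : option 'I_n -> Pfci I =>
    u None = @eval LL (LI I) n (u \o Some) t).
Proof.
elim: t => [i|f args IH].
  have := recognizableI (recognizable_sub None (Some i)) (recognizable_sub (Some i) None).
  apply: recognizable_ext => u; rewrite Pfci_eq.
  by split=> [[h h'] p|h]; [split; [exact: h|exact: h']|split=> p /h].
pose g (k : 'I_(arity f)) (o : option 'I_n) : option 'I_n + 'I_(arity f) :=
  if o is Some i then inl (Some i) else inr k.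
pose h (o : option 'I_(arity f)) : option 'I_n + 'I_(arity f) :=
  if o is Some k then inr k else inl None.
have := recognizable_ex (recognizableI
  (recognizable_all (fun k => recognizable_reindex (g k) (IH k)))
  (recognizable_reindex h (recognizable_graph f))).
apply: recognizable_ext => u; split=> [[x [hx ux]]|ux].
  rewrite [LHS]ux /=; congr (LI_interp _); apply/funext => k; exact: hx.
by exists (fun k => @eval LL (LI I) n (u \o Some) (args k)).
Qed.

Lemma recognizable_sat n (phi : formula LL n) :
  recognizable (fun v : 'I_n -> Pfci I => @sat LL (LI I) n phi v).
Proof.
elim: phi => {n} [n s t|n p IH|n p IHp q IHq|n p IHp q IHq|n p IHp q IHq|n p IH|n p IH] /=.
- have := recognizable_ex1 (recognizableI (recognizable_eval s) (recognizable_eval t)).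
  apply: recognizable_ext => v; split=> [[a [/= <- <-]]|e] //.
  by exists (@eval LL (LI I) n v s).
- exact: recognizableC.
- exact: recognizableI.
- exact: recognizableU.
- exact: recognizable_imply.
(* By computation [extend a v] is [ocons a v \o unlift ord0]. *)
- exact: recognizable_ex1 (recognizable_reindex (unlift ord0) IH).
- exact: recognizable_all1 (recognizable_reindex (unlift ord0) IH).
Qed.

(** * Existential definability *)

Section Definability.

Definition qf_definable n (R : ('I_n -> Pfci I) -> Prop) :=
  exists2 phi : formula LL n, quantifier_free phi &
    forall v, @sat LL (LI I) n phi v <-> R v.

Definition ex_definable n (R : ('I_n -> Pfci I) -> Prop) :=
  exists2 phi : formula LL n, existential phi &
    forall v, @sat LL (LI I) n phi v <-> R v.

Lemma qf_ex_definable n (R : ('I_n -> Pfci I) -> Prop) :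
  qf_definable R -> ex_definable R.
Proof. by move=> [phi qphi h]; exists phi => //; case: {h} phi qphi. Qed.

Lemma qf_definable_ext n (R R' : ('I_n -> Pfci I) -> Prop) :
  (forall v, R v <-> R' v) -> qf_definable R -> qf_definable R'.
Proof. by move=> e [phi q h]; exists phi => // v; rewrite h. Qed.

Lemma qf_definable_eq n (s t : term LL n) :
  qf_definable (fun v => @eval LL (LI I) n v s = @eval LL (LI I) n v t).
Proof. by exists (Eq s t). Qed.

Lemma qf_definableC n (R : ('I_n -> Pfci I) -> Prop) :
  qf_definable R -> qf_definable (fun v => ~ R v).
Proof. by move=> [phi q h]; exists (Neg phi) => // v /=; rewrite h. Qed.

Lemma qf_definableI n (R R' : ('I_n -> Pfci I) -> Prop) :
  qf_definable R -> qf_definable R' -> qf_definable (fun v => R v /\ R' v).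
Proof.
move=> [phi q h] [phi' q' h']; exists (And phi phi'); first by rewrite /= q.
by move=> v /=; rewrite h h'.
Qed.

Definition app0 n (f : LL) (f0 : arity f = 0) : term LL n :=
  @App LL n f (fun k => False_rect _
    (notF (etrans (esym (ltn0 k)) (eq_ind _ (fun m => (k < m)%N) (ltn_ord k) _ f0)))).
Definition app1 n (f : LL) (t : term LL n) : term LL n := @App LL n f (fun=> t).
Definition app2 n (f : LL) (s t : term LL n) : term LL n :=
  @App LL n f (fun k => if k == 0 :> nat then s else t).

Lemma qf_definable_True n : qf_definable (fun _ : 'I_n -> Pfci I => True).
Proof.
by apply: qf_definable_ext (qf_definable_eq (app0 n (f := LLbot) erefl) _).
Qed.

Lemma qf_definable_all n (K : finType) (R : K -> ('I_n -> Pfci I) -> Prop) :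
  (forall k, qf_definable (R k)) -> qf_definable (fun v => forall k, R k v).
Proof.
move=> h; suff H (s : seq K) : qf_definable (fun v => forall k, k \in s -> R k v).
  apply: qf_definable_ext (H (enum K)) => v.
  by split=> Rv k => [|_]; apply: Rv; rewrite ?mem_enum.
elim: s => [|k s IHs]; first exact: qf_definable_ext (qf_definable_True n).
apply: qf_definable_ext (qf_definableI (h k) IHs) => v; split=> [[Rk Rs] k'|Rv].
  by rewrite inE => /orP[/eqP->//|]; exact: Rs.
by split=> [|k' k's]; apply: Rv; rewrite inE ?eqxx ?k's ?orbT.
Qed.

(** This makes being the whole line a quantifier-free condition. Conversely, starting from 0, a set
    without right endpoints continues through each gap and, being closed, contains the end of the
    gap. *)
Lemma full_endpointsP (A : Pfci I) :
  (forall p, sval A p) <->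
  left_endpoints (sval A) = [set \bot] /\ right_endpoints (sval A) = set0.
Proof.
split=> [fA|[lA rA] p].
  have A0 := fA \bot; split; apply/seteqP; split=> p //=.
  - apply: contraPeq => p0 lp.
    have [_] : left_in (sval A) p; last exact.
    by apply/(left_inP _ (svalP A)); exists \bot; rewrite ?lt0x.
  - by move=> ->; apply: left_endpointsI => // x; rewrite ltx0.
  - have [q pq] := nomax p => rp.
    have [_] : right_in (sval A) p; last exact.
    by apply/(right_inP _ (svalP A)); exists q.
pose u (_ : unit) := A.
suff : right_in (sval A) p by case.
apply: (@flat_ladder _ u (right_in (sval A)) \bot); last exact: le0x.
  split; last by rewrite rA.
  by apply: left_endpoints_sub; rewrite lA.
move=> q r g _ qr f rq; split; last by rewrite rA.
suff /asboolP[] : lletter u r tt by [].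
rewrite (flat_lletter f qr (lexx r)) -(flat_rletter f (lexx q) qr).
exact/asboolP.
Qed.

Lemma union_term n (K : eqType) (t : K -> term LL n) (s : seq K) :
  exists w, forall v p, sval (@eval LL (LI I) n v w) p <->
    exists2 k, k \in s & sval (@eval LL (LI I) n v (t k)) p.
Proof.
elim: s => [|k s [w hw]].
  by exists (app0 n (f := LLbot) erefl) => v p; split=> // -[].
exists (app2 LLcup (t k) w) => v p; split=> [[kp|/hw[k' k's k'p]]|[k' + k'p]].
- by exists k; rewrite ?mem_head.
- by exists k'; rewrite // inE k's orbT.
- rewrite inE => /orP[/eqP <-|k's]; first by left.
  by right; apply/hw; exists k'.
Qed.

(** The head [k0] keeps the intersection nonempty as a list. *)
Lemma inter_term n (K : eqType) (t : K -> term LL n) (k0 : K) (s : seq K) :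
  exists w, forall v p, sval (@eval LL (LI I) n v w) p <->
    forall k, k \in k0 :: s -> sval (@eval LL (LI I) n v (t k)) p.
Proof.
elim: s => [|k s [w hw]].
  by exists (t k0) => v p; split=> [kp k|]; [rewrite inE => /eqP ->|apply; rewrite mem_head].
exists (app2 LLcap (t k) w) => v p; split=> [[kp /hw h] k'|h].
  by rewrite !inE => /or3P[k's|/eqP->//|k's]; apply: h; rewrite inE k's ?orbT.
split; first by apply: h; rewrite !inE eqxx orbT.
by apply/hw => k' k's; apply: h; move: k's; rewrite !inE => /orP[->|->]; rewrite ?orbT.
Qed.

(** Each of the finitely many patterns [c] outside [T] is excluded separately: no point has pattern
    [c] exactly when the intersection of the terms selected by [c] is included in the union of the
    others. *)
Lemma qf_definable_points n (K : finType) (t : K -> term LL n)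
    (T : (K -> bool) -> Prop) :
  qf_definable (fun v =>
    forall p, T (fun k => `[< sval (@eval LL (LI I) n v (t k)) p >])).
Proof.
have -> : (fun v => forall p, T (fun k => `[< sval (@eval LL (LI I) n v (t k)) p >])) =
    (fun v => forall c : {ffun K -> bool}, ~ T c ->
      forall p, (forall k, c k -> sval (@eval LL (LI I) n v (t k)) p) ->
      exists2 k, ~~ c k & sval (@eval LL (LI I) n v (t k)) p).
  apply/funext => v; apply/propext; split=> [h c nT p cp|h p].
    apply: contrapT => N; apply: nT.
    have := h p; congr T; apply/funext => k; apply: asbool_eq.
    by split=> [kp|/cp//]; apply: contrapT => /negP ck; apply: N; exists k.
  apply: contrapT => nT; have [|k|k] := h [ffun k => `[< sval (@eval LL (LI I) n v (t k)) p >]] _ p.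
  - by move: nT; congr (~ T _); apply/funext => k; rewrite ffunE.
  - by rewrite ffunE => /asboolP.
  - by rewrite ffunE => /asboolP.
apply: qf_definable_all => c.
have [Tc|nTc] := pselect (T c).
  by apply: qf_definable_ext (qf_definable_True n) => v; split.
have [w hw] := union_term t [seq k <- enum K | ~~ c k].
have {}hw v p : sval (@eval LL (LI I) n v w) p <->
    exists2 k, ~~ c k & sval (@eval LL (LI I) n v (t k)) p.
  rewrite hw; split=> -[k kc kp]; exists k => //.
    by move: kc; rewrite mem_filter => /andP[].
  by rewrite mem_filter kc mem_enum.
(* An empty intersection is the whole line, for which there is no constant. *)
have [[k0 ck0]|N] := pselect (exists k, c k).
  have [z hz] := inter_term t k0 [seq k <- enum K | c k].
  apply: qf_definable_ext (qf_definable_eq (app2 LLcap z w) z) => v.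
  rewrite Pfci_eq; split=> [h _ p cp|h p].
    apply/hw; have [] // : sval (@eval LL (LI I) n v (app2 LLcap z w)) p.
    apply/h/hz => k; rewrite inE mem_filter => /orP[/eqP->|/andP[ck _]]; exact: cp.
  split=> [[]//|zp]; split=> //; apply/hw/(h nTc) => k ck.
  by move/hz: zp; apply; rewrite inE mem_filter ck mem_enum orbT.
apply: qf_definable_ext (qf_definableI
  (qf_definable_eq (app1 LLl w) (app0 n (f := LLzero) erefl))
  (qf_definable_eq (app1 LLr w) (app0 n (f := LLbot) erefl))) => v.
rewrite !Pfci_sval_eq -[_ /\ _](full_endpointsP (@eval LL (LI I) n v w)).
split=> [h _ p _|h p]; first by apply/hw.
by apply/hw/(h nTc) => k ck; case: N; exists k.
Qed.

Lemma qf_definable_local n (U : finType) (t : U -> term LL n) D F :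
  qf_definable (fun v => local_rel D F (fun i => @eval LL (LI I) n v (t i))).
Proof.
apply: qf_definableI.
  (* Membership in these terms determines the flag and the three letters: a germ holds at the points
     of the set that are not endpoints on that side. *)
  pose s (k : unit + (U + (U + U))) : term LL n := match k with
    | inl _ => app0 n (f := LLzero) erefl
    | inr (inl i) => t i
    | inr (inr (inl i)) => app1 LLl (t i)
    | inr (inr (inr i)) => app1 LLr (t i) end.
  pose T (c : unit + (U + (U + U)) -> bool) := D (c (inl tt))
    (fun i => c (inr (inl i)) && ~~ c (inr (inr (inl i))))
    (fun i => c (inr (inl i)))
    (fun i => c (inr (inl i)) && ~~ c (inr (inr (inr i)))).
  apply: qf_definable_ext (qf_definable_points s T) => v.
  suff e p : allowed D (fun i => @eval LL (LI I) n v (t i)) p =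
      T (fun k => `[< sval (@eval LL (LI I) n v (s k)) p >]).
    by split=> h p; have := h p; rewrite e.
  rewrite /allowed /T; congr D.
  - by apply/esym/asbool_eq; split=> /eqP.
  - by apply/funext => i; rewrite -asbool_neg -asbool_and.
  - by apply/funext => i; rewrite -asbool_neg -asbool_and.
(* The condition at infinity is likewise a finite conjunction, excluding each letter that [F]
   rejects. *)
have -> : (fun v => F (eletter (fun i => @eval LL (LI I) n v (t i)))) =
    (fun v => forall c : {ffun U -> bool}, ~ F c ->
      ~ forall i, eletter (fun i => @eval LL (LI I) n v (t i)) i = c i).
  apply/funext => v; apply/propext; split=> [Fv c nF h|h].
    by apply: nF; move: Fv; congr F; apply/funext.
  apply: contrapT => nF; apply: (h (finfun (eletter (fun i => @eval LL (LI I) n v (t i))))).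
    by move: nF; congr (~ F _); apply/funext => i; rewrite ffunE.
  by move=> i; rewrite ffunE.
apply: qf_definable_all => c; have [Fc|nFc] := pselect (F c).
  by apply: qf_definable_ext (qf_definable_True n) => v; split.
suff H i : qf_definable (fun v => eletter (fun i => @eval LL (LI I) n v (t i)) i = c i).
  apply: qf_definable_ext (qf_definableC (qf_definable_all H)) => v.
  by split=> // h; exact: h nFc.
have H : qf_definable (fun v => end_in (sval (@eval LL (LI I) n v (t i)))).
  apply: qf_definable_ext (qf_definableI
    (qf_definableC (qf_definable_eq (t i) (app0 n (f := LLbot) erefl)))
    (qf_definable_eq (app1 LLmax (t i)) (app0 n (f := LLbot) erefl))) => v.
  rewrite !Pfci_sval_eq /end_in /=; split=> -[h ->]; split=> //; first by apply/set0P/eqP.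
  by apply/eqP/set0P.
case: (c i).
  by apply: qf_definable_ext H => v; split=> /asboolP.
by apply: qf_definable_ext (qf_definableC H) => v; split=> [/asboolF|/asboolPn].
Qed.

(** * Blocks of existential quantifiers *)

Fixpoint term_map n m (f : 'I_n -> 'I_m) (t : term LL n) : term LL m :=
  match t with
  | Var i => @Var LL m (f i)
  | App g args => @App LL m g (fun k => term_map f (args k))
  end.

Lemma eval_term_map n m (f : 'I_n -> 'I_m) (t : term LL n) v :
  @eval LL (LI I) m v (term_map f t) = @eval LL (LI I) n (v \o f) t.
Proof.
elim: t => [//|g args IH] /=; congr (LI_interp _); apply/funext => k; exact: IH.
Qed.

Lemma extend_lift n (a : Pfci I) (v : 'I_n -> Pfci I) : extend a v \o lift ord0 = v.
Proof. by apply/funext => i; rewrite /extend /= liftK. Qed.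

Lemma ex_definable_ex n (R : ('I_n.+1 -> Pfci I) -> Prop) :
  ex_definable R -> ex_definable (fun v => exists a, R (extend a v)).
Proof.
move=> [phi e h]; exists (Ex phi) => // v /=.
by split=> -[a ha]; exists a; apply/h.
Qed.

(** The hypothesis is stated for all substitutions of terms, so that it survives the shift of
    variables under each new quantifier. *)
Lemma ex_definable_block n (W : finType) (R : (W -> Pfci I) -> ('I_n -> Pfci I) -> Prop) :
  (forall k (s : W -> term LL k) (t : 'I_n -> term LL k), qf_definable (fun u =>
    R (fun w => @eval LL (LI I) k u (s w)) (fun i => @eval LL (LI I) k u (t i)))) ->
  ex_definable (fun v => exists z, R z v).
Proof.
move=> hR.
(* [ws] lists the indices still to be quantified; the other members of the family are already given
   by [s]. *)
suff H (ws : seq W) : forall k (s : W -> term LL k) (t : 'I_n -> term LL k),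
    ex_definable (fun u => exists2 z, R z (fun i => @eval LL (LI I) k u (t i)) &
      forall w, w \notin ws -> z w = @eval LL (LI I) k u (s w)).
  (* All of [W] remains to be quantified, so the initial terms are dummies. *)
  have [phi ephi h] := H (enum W) n (fun=> app0 n (f := LLbot) erefl) (@Var LL n).
  exists phi => // v; rewrite h; split=> [[z Rz _]|[z Rz]]; exists z => // w.
  by rewrite mem_enum.
elim: ws => [|w0 ws IH] k s t.
  apply: qf_ex_definable; apply: qf_definable_ext (hR k s t) => u.
  split=> [Ru|[z Rz hz]]; first by eexists; first exact: Ru.
  by move: Rz; congr R; apply/funext => w; exact: hz.
(* The new quantifier binds the value at [w0]; the other terms are weakened. *)
pose s' w := if w == w0 then @Var LL k.+1 ord0 else term_map (lift ord0) (s w).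
have [phi ephi h] := ex_definable_ex (IH _ s' (fun i => term_map (lift ord0) (t i))).
exists phi => // u; rewrite h.
have et a : (fun i => @eval LL (LI I) _ (extend a u) (term_map (lift ord0) (t i))) =
    (fun i => @eval LL (LI I) _ u (t i)).
  by apply/funext => i; rewrite eval_term_map extend_lift.
split=> [[a [z]]|[z Rz hz]].
  rewrite et => Rz hz; exists z => // w; rewrite inE negb_or => /andP[ww0 wws].
  by rewrite hz // /s' (negPf ww0) eval_term_map extend_lift.
exists (z w0), z; first by rewrite et.
move=> w wws; rewrite /s'; have [->|ww0] := eqVneq w w0.
  by rewrite /= /extend unlift_none.
by rewrite eval_term_map extend_lift hz // inE negb_or ww0.
Qed.

Lemma recognizable_ex_definable n (R : ('I_n -> Pfci I) -> Prop) :
  recognizable R -> ex_definable R.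
Proof.
move=> [W [D [F h]]].
have [|phi ephi hphi] := @ex_definable_block n W (fun z v => local_rel D F (glue v z)).
  move=> k s t; apply: qf_definable_ext (qf_definable_local (glue t s) D F) => u.
  by rewrite (_ : (fun i => _) = glue (fun i => @eval LL (LI I) k u (t i))
    (fun w => @eval LL (LI I) k u (s w))) //; apply/funext; case.
by exists phi => // v; rewrite hphi h.
Qed.

End Definability.

End Germs.

Theorem theorem6p15 (d : Order.disp_t) (I : bOrderType d)
    (dense : forall x y : I, (x < y)%O -> exists z : I, (x < z)%O /\ (z < y)%O)
    (no_greatest : forall x : I, exists y : I, (x < y)%O) :
  model_complete (LI I).
Proof.
move=> n phi.
have [psi e h] := recognizable_ex_definable dense no_greatest
  (recognizable_sat dense no_greatest phi).
by exists psi => // v; rewrite h.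
Qed.
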